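(* Let $\Delta>0$, and let $G$ be the $n\times n$ grid whose edge weights are i.i.d. and take each of the values $v_1=1$ and $v_2=1+\Delta$ with probability $\frac12$. Then the average performance ratio of Algorithm 1 (greedy matching) satisfies $$\lim_{n\to\infty}PR(G)\;\ge\;\frac{0.9213+0.6967\,\Delta}{1+0.9375\,\Delta}.$$ This lower bound on the ratio decreases from $92.1\%$ to $74.3\%$ (rounded values) when $\Delta$ increases from $0^+$ to $\infty$.
   Context: The $n\times n$ grid has $n^2$ users placed at the points of an $n\times n$ array, two users being adjacent iff they are horizontally or vertically neighboring; users are indexed row by row (so the right neighbor of $u_i$ is $u_{i+1}$ and the neighbor below $u_i$ is $u_{i+n}$). $W$ is the vector of edge weights. Algorithm 1 (greedy matching): initially all users are unmatched. Each iteration has two phases. Proposal phase: every unmatched user having at least one unmatched neighbor sends a proposal to the unmatched neighbor to which it is joined by the edge of largest weight; among neighbors with equal weights, the one of smaller index has priority. Matching phase: every pair of users that proposed to each other is matched and becomes unavailable to others. The algorithm stops when no unmatched user has an unmatched neighbor. $\hat f(G,W)$ is the total weight of the matching returned by Algorithm 1, $f^\star(G,W)$ is the maximum total weight of a matching of $(G,W)$, and the average performance ratio is $PR(G)=\mathbb{E}_W[\hat f(G,W)]/\mathbb{E}_W[f^\star(G,W)]$. *)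

(* Defs.v *)
From HB Require Import structures.
From mathcomp Require Import all_boot all_order all_algebra.
From mathcomp Require Import reals.
Import Order.TTheory GRing.Theory Num.Theory.

Set Implicit Arguments.
Unset Strict Implicit.
Unset Printing Implicit Defensive.

Local Open Scope ring_scope.

Section WeightedGraph.
Variables (V : finType) (adj : rel V).

Definition edges : {set {set V}} :=
  [set e : {set V} | [exists x, exists y, adj x y && (e == [set x; y])]].

Definition edge : finType := {e : {set V} | e \in edges}.

Definition is_matching (M : {set edge}) : bool :=
  [forall e in M, forall e' in M, (e != e') ==> [disjoint val e & val e']].

Variable R : realDomainType.
Implicit Types (W : edge -> R) (M : {set edge}) (x y : V).

Definition total_weight W M : R := \sum_(e in M) W e.

(* The empty matching has weight 0, so the default value is harmless. *)
Definition fstar W : R :=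
  \big[Num.max/0]_(M : {set edge} | is_matching M) total_weight W M.

(* The value 0 is junk: it is only reached when {x, y} is not an edge. *)
Definition weight W x y : R :=
  if insub [set x; y] is Some e then W e else 0.

Variable idx : V -> nat.

Definition unmatched M x : bool := [forall e in M, x \notin val e].

Definition proposes W M x y : bool :=
  [&& unmatched M x, unmatched M y, adj x y &
      [forall z, (unmatched M z && adj x z) ==>
         (weight W x z < weight W x y)
         || (weight W x z == weight W x y) && (idx y <= idx z)%N]].

Definition greedy_step W M : {set edge} :=
  M :|: [set e : edge | [exists x, exists y,
           [&& val e == [set x; y], proposes W M x y & proposes W M y x]]].

Definition stopped M : bool :=
  ~~ [exists x, exists y, [&& unmatched M x, unmatched M y & adj x y]].

(* [greedy_step] is the identity on stopped states, and #|V| iterations are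
   enough to stop: see [greedy_step_stopped] and [greedy_stopped]. *)
Definition greedy W : {set edge} := iter #|V| (greedy_step W) set0.

Definition fhat W : R := total_weight W (greedy W).

Lemma greedy_step_stopped W M : stopped M -> greedy_step W M = M.
Proof.
move=> /existsPn Mstop; apply/setUidPl/subsetP => e.
rewrite inE => /existsP[x /existsP[y /and3P[_ /and4P[ux uy xy _] _]]].
by case/existsP: (Mstop x); exists y; rewrite ux uy xy.
Qed.

Lemma card_unmatched_step W M : symmetric adj -> ~~ stopped M ->
  (#|unmatched (greedy_step W M)| < #|unmatched M|)%N.
Proof.
move=> adjC /negPn/existsP[x0 /existsP[y0 P0]].
pose P (p : V * V) := [&& unmatched M p.1, unmatched M p.2 & adj p.1 p.2].
have P00 : P (x0, y0) by [].
case: (arg_maxP (fun p => weight W p.1 p.2) P00) => p1 Pp1 max1.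
pose Q p := P p && (weight W p.1 p.2 == weight W p1.1 p1.2).
have Q1 : Q p1 by rewrite /Q Pp1 eqxx.
case: (arg_minnP (fun p => idx p.1 + idx p.2)%N Q1) => -[x y] /andP[Pxy /eqP wxy].
move=> min2; rewrite /= in wxy; move: (Pxy) => /and3P[/= ux uy xy].
have weightC a b : weight W a b = weight W b a by rewrite /weight setUC.
have prop_xy : proposes W M x y.
  rewrite /proposes ux uy xy; apply/forallP => z; apply/implyP => /andP[uz xz].
  have Pxz : P (x, z) by rewrite /P ux uz xz.
  rewrite wxy; have := max1 _ Pxz; rewrite /= le_eqVlt => /predU1P[wE|->//].
  apply/orP; right; rewrite wE eqxx /=.
  by have := min2 (x, z); rewrite /Q Pxz /= wE eqxx leq_add2l; apply.
have prop_yx : proposes W M y x.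
  rewrite /proposes ux uy adjC xy; apply/forallP => z.
  apply/implyP => /andP[uz yz].
  have Pyz : P (y, z) by rewrite /P uy uz yz.
  rewrite (weightC y x) wxy; have := max1 _ Pyz.
  rewrite /= le_eqVlt => /predU1P[wE|->//].
  apply/orP; right; rewrite wE eqxx /=.
  have := min2 (y, z); rewrite /Q Pyz /= wE eqxx (addnC (idx x)) leq_add2l.
  exact.
have Exy : [set x; y] \in edges.
  by rewrite inE; apply/existsP; exists x; apply/existsP; exists y; rewrite xy /=.
apply/proper_card/properP; split.
  apply/subsetP => z /forallP uz; apply/forallP => e; apply/implyP => eM.
  by apply: (implyP (uz e)); rewrite inE eM.
exists x; first exact: ux.
pose e0 : edge := exist _ [set x; y] Exy.
have e0M : e0 \in greedy_step W M.
  rewrite !inE; apply/orP; right; apply/existsP; exists x; apply/existsP.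
  by exists y; rewrite eqxx prop_xy prop_yx.
apply/negP => /forallP /(_ e0) /implyP /(_ e0M) /negP; apply.
by rewrite /= !inE eqxx.
Qed.

Lemma greedy_stopped W : symmetric adj -> stopped (greedy W).
Proof.
move=> adjC; rewrite /greedy.
suff H k : stopped (iter k (greedy_step W) set0) \/
    (#|unmatched (iter k (greedy_step W) set0)| + k <= #|V|)%N.
  case: (H #|V|) => //; rewrite addnC -[leqRHS]addn0 leq_add2l leqn0.
  move=> /eqP/card0_eq U0.
  by apply/existsPn => x; apply/existsPn => y; rewrite [unmatched _ x](U0 x).
elim: k => [|k [Sk|IHk]]; first by right; rewrite addn0 max_card.
  by left; rewrite iterS greedy_step_stopped.
have [Sk|Sk] := boolP (stopped (iter k (greedy_step W) set0)).
  by left; rewrite iterS greedy_step_stopped.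
right; rewrite addnS -addSn iterS; apply: leq_trans IHk.
by rewrite leq_add2r card_unmatched_step.
Qed.

End WeightedGraph.

Section Grid.
Variable n : nat.

Definition cell : finType := ('I_n * 'I_n)%type.

(* Row-by-row numbering, from 0 instead of 1; a cell is (row, column). *)
Definition cell_idx (x : cell) : nat := (x.1 * n + x.2)%N.

Definition grid_adj : rel cell := fun x y =>
  (x.1 == y.1) && ((x.2.+1 == y.2 :> nat) || (y.2.+1 == x.2 :> nat))
  || (x.2 == y.2) && ((x.1.+1 == y.1 :> nat) || (y.1.+1 == x.1 :> nat)).

Definition grid_edge : finType := edge grid_adj.

End Grid.

Section PerformanceRatio.
Variable R : realType.

(* Expectation of F(X) when X = (X_i)_{i : I} is a family of independent random
   variables which all have probability mass function p on the finite type T. *)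
Definition iid_expectation (I T : finType) (p : T -> R)
    (F : {ffun I -> T} -> R) : R :=
  \sum_(X : {ffun I -> T}) (\prod_(i : I) p (X i)) * F X.

Definition fair_coin (b : bool) : R := 1 / 2.

Definition two_values (Delta : R) (b : bool) : R := if b then 1 + Delta else 1.

Definition expected_weight (n : nat) (Delta : R)
    (f : (grid_edge n -> R) -> R) : R :=
  iid_expectation fair_coin
    (fun X : {ffun grid_edge n -> bool} => f (fun e => two_values Delta (X e))).

Definition PR (n : nat) (Delta : R) : R :=
  expected_weight Delta (@fhat _ (@grid_adj n) R (@cell_idx n))
  / expected_weight Delta (@fstar _ (@grid_adj n) R).

Definition lower_bound (Delta : R) : R :=
  (9213 / 10000 + 6967 / 10000 * Delta) / (1 + 9375 / 10000 * Delta).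

(* r, expressed in percent, is k / 10 once rounded to one decimal. *)
Definition rounds_to_permille (r : R) (k : nat) : Prop :=
  `|r - k%:R / 1000| < 1 / 2000.

End PerformanceRatio.

(* Main.v *)
From Stdlib Require Import BinNat Nnat.
Require Import Defs.
From mathcomp Require Import all_boot all_order all_algebra.
From mathcomp Require Import all_classical all_reals all_analysis.
From mathcomp Require Import ring lra zify.
Import Order.TTheory GRing.Theory Num.Theory.
Import numFieldNormedType.Exports.

(* Since two edges at a vertex never have the same index sum, Algorithm 1 builds
   the greedy matching which examines first the heavy edges and then the light
   ones, both row by row: in each row the horizontal edges from left to right, then
   the vertical edges below the row.

   Existence of the limit: making a vertex unavailable changes the weight of a
   greedy or optimal matching by at most one edge weight, so that cutting the grid
   into k x k blocks changes it by O(n^2 / k). Hence E f / n^2 is a Cauchy sequence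
   for both f = fhat and f = fstar.

   Denominator: a vertex contributes half of its edge to a matching, and this edge
   can be heavy only if one of the at most 4 incident edges is, which has
   probability at most 15/16.

   Numerator: the rows are processed by a finite automaton which reads a row from
   left to right, with fresh coins, and sends one symbol per column to the next row.
   For h consecutive rows whose input symbols are chosen by an adversary, a table V
   on the states of the h automata which satisfies
   min_x E[gain in the last row + V(next states)] >= V(states) + kappa
   shows that every column of the last row gets at least kappa matched edges on
   average. A table computed by value iteration gives kappa = 0.4607 >= 0.9213 / 2
   for all edges with h = 5, and kappa = 0.349 >= 0.6967 / 2 for the heavy ones with
   h = 2. *)

Set Implicit Arguments.
Unset Strict Implicit.
Unset Printing Implicit Defensive.
Local Open Scope ring_scope.

(** * Expectations over independent fair coins *)

Section Expect.
Variables (R : realType) (T : eqType).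
Implicit Types (X Y : T -> bool) (F G : (T -> bool) -> R) (l : seq T) (e : T).

Definition upd X e b : T -> bool := fun e' => if e' == e then b else X e'.

Definition indep A (F : (T -> bool) -> A) e := forall X b, F (upd X e b) = F X.

Definition mean e F X : R := (F (upd X e true) + F (upd X e false)) / 2.

(** Averages over the coins in [l]; all other coins are frozen at [false]. Configurations are
    defined on the whole of [T], so that grids and blocks of all sizes can share the same
    functions. *)
Definition expect l F : R := foldr mean F l (fun _ => false).

Lemma upd_id X e b b' : upd (upd X e b) e b' = upd X e b'.
Proof. by apply/funext => e'; rewrite /upd; case: eqP. Qed.

Lemma updC X e e' b b' : e != e' ->
  upd (upd X e b) e' b' = upd (upd X e' b') e b.
Proof.
move=> ee'; apply/funext => x; rewrite /upd.
by case: (x =P e') => // ->; rewrite eq_sym (negbTE ee').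
Qed.

Lemma indep_mean e F : indep (mean e F) e.
Proof. by move=> X b; rewrite /mean !upd_id. Qed.

Lemma mean_indep e F : indep F e -> mean e F = F.
Proof. by move=> Fe; apply/funext => X; rewrite /mean !Fe; field. Qed.

Lemma indep_mean_other e e' F : indep F e -> indep (mean e' F) e.
Proof.
have [-> _|ee' Fe X b] := eqVneq e' e; first exact: indep_mean.
by rewrite /mean !(updC _ _ _ (_ : e != e')) ?Fe // eq_sym.
Qed.

Lemma mean_comm e e' F : mean e (mean e' F) = mean e' (mean e F).
Proof.
have [->//|ee'] := eqVneq e e'.
by apply/funext => X; rewrite /mean !(@updC _ e' e) ?(eq_sym e') //; field.
Qed.

Lemma indep_foldr e F l : (e \notin l -> indep F e) -> indep (foldr mean F l) e.
Proof.
elim: l => [|e' l IHl] /=; first exact.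
rewrite inE negb_or; have [<- _|_ Fe] := eqVneq e e'; first exact: indep_mean.
by apply: indep_mean_other; apply: IHl => el; apply: Fe.
Qed.

Lemma foldr_mean_comm e F l : foldr mean (mean e F) l = mean e (foldr mean F l).
Proof. by elim: l => //= e' l ->; rewrite mean_comm. Qed.

(** Means commute, so the additional mean over [e] can be performed last, when the function no
    longer depends on [e]. Used from right to left, this exposes a single coin of an expectation. *)
Lemma expect_mean e F l : e \in l -> expect l (mean e F) = expect l F.
Proof.
move=> el; rewrite /expect foldr_mean_comm mean_indep //.
by apply: indep_foldr; rewrite el.
Qed.

Lemma indep_const A (F : (T -> bool) -> A) l X Y :
  {in l, forall e, indep F e} -> {in [predC l], X =1 Y} -> F X = F Y.
Proof.
elim: l X => [|e l IHl] X Fl XY.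
  by congr F; apply/funext => e; apply: XY.
rewrite -[LHS](Fl _ (mem_head _ _) _ (Y e)); apply: IHl.
  by move=> e' el; apply: Fl; rewrite inE el orbT.
move=> e' /= el; rewrite /upd; case: eqP => [->//|/eqP ee'].
by apply: XY; rewrite !inE negb_or ee'.
Qed.

Lemma eq_expect l F G : F =1 G -> expect l F = expect l G.
Proof. by move=> /funext ->. Qed.

Lemma expect_const l (c : R) : expect l (fun _ => c) = c.
Proof.
rewrite /expect; suff -> : foldr mean (fun=> c) l = fun _ => c by [].
by elim: l => //= e l ->; apply: mean_indep.
Qed.

Lemma expectD l F G : expect l (fun X => F X + G X) = expect l F + expect l G.
Proof.
rewrite /expect; suff -> : foldr mean (fun X => F X + G X) l =
    fun X => foldr mean F l X + foldr mean G l X by [].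
by elim: l => //= e l ->; apply/funext => X; rewrite /mean; field.
Qed.

Lemma expectZ l c F : expect l (fun X => c * F X) = c * expect l F.
Proof.
rewrite /expect; suff -> : foldr mean (fun X => c * F X) l =
    fun X => c * foldr mean F l X by [].
by elim: l => //= e l ->; apply/funext => X; rewrite /mean; field.
Qed.

Lemma expectN l F : expect l (fun X => - F X) = - expect l F.
Proof.
by rewrite -mulN1r -expectZ; apply: eq_expect => X; rewrite mulN1r.
Qed.

Lemma expectB l F G : expect l (fun X => F X - G X) = expect l F - expect l G.
Proof. by rewrite expectD expectN. Qed.

Lemma expect_sum (I : Type) (r : seq I) (P : pred I) l (F : I -> (T -> bool) -> R) :
  expect l (fun X => \sum_(i <- r | P i) F i X) =
  \sum_(i <- r | P i) expect l (F i).
Proof.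
elim: r => [|i r IHr].
  by under eq_expect do rewrite big_nil; rewrite big_nil expect_const.
under eq_expect do rewrite big_cons; rewrite big_cons -IHr.
by case: ifP => // _; rewrite expectD.
Qed.

Lemma ler_expect l F G : (forall X, F X <= G X) -> expect l F <= expect l G.
Proof.
rewrite /expect => FG; elim: l (fun=> false) => //= e l IHl X.
by rewrite /mean ler_pM2r ?invr_gt0 ?ltr0n // lerD.
Qed.

Lemma ler_norm_expect l F : `|expect l F| <= expect l (fun X => `|F X|).
Proof.
rewrite ler_norml -expectN; apply/andP.
by split; apply: ler_expect => X; [rewrite lerNl -normrN|]; apply: ler_norm.
Qed.

(** Averaging over [l] first does not change the expectation over [l']. The averaged function
    depends on no coin of [l'], so the other means are trivial. *)
Lemma expect_sub l l' F : {subset l <= l'} ->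
  {in l', forall e, e \notin l -> indep F e} -> expect l' F = expect l F.
Proof.
move=> ll' Fl.
have -> : expect l' F = expect l' (foldr mean F l).
  elim: l ll' {Fl} => //= e l IHl ll'; rewrite expect_mean ?ll' ?mem_head //.
  by apply: IHl => x xl; rewrite ll' // inE xl orbT.
rewrite {1}/expect.
suff : {in l', forall e, indep (foldr mean F l) e}.
  by elim: (l') => //= e s IHs H; rewrite mean_indep ?IHs //;
    [move=> x xs; apply: H; rewrite inE xs orbT
    | apply: indep_foldr => _; apply: H; rewrite mem_head].
by move=> e el'; apply: indep_foldr => el; apply: Fl.
Qed.

End Expect.

Lemma expect_map (R : realType) (T U : eqType) (f : T -> U) (l : seq T)
    (F : (T -> bool) -> R) : injective f ->
  expect (map f l) (fun X => F (X \o f)) = expect l F.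
Proof.
move=> f_inj; rewrite /expect.
suff H X : foldr (@mean R U) (fun X => F (X \o f)) (map f l) X =
   foldr (@mean R T) F l (X \o f) by rewrite H.
elim: l X => //= e l IHl X; rewrite /mean !IHl.
suff E b : upd X (f e) b \o f = upd (X \o f) e b by rewrite !E.
by apply/funext => x; rewrite /upd /= (inj_eq f_inj).
Qed.

Section IidExpect.
Variables (R : realType) (I : finType).

(** Flipping one coin permutes the configurations, so [avg] is invariant under [mean e]. Once all
    coins have been averaged the function is constant, and the probabilities of the configurations
    sum to 1. *)
Lemma iid_expectation_expect (F : {ffun I -> bool} -> R) :
  iid_expectation (@fair_coin R) F = expect (enum I) (fun X => F (finfun X)).
Proof.
pose avg (G : (I -> bool) -> R) : R :=
  \sum_(X : {ffun I -> bool}) (\prod_(i : I) fair_coin R (X i)) * G X.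
have avg_mean e G : avg (mean e G) = avg G.
  have coinE (X : {ffun I -> bool}) :
      \prod_(i : I) fair_coin R (X i) = (1 / 2) ^+ #|I|.
    by rewrite prodr_const.
  pose flip (X : {ffun I -> bool}) : {ffun I -> bool} :=
    finfun (upd X e (~~ X e)).
  have flipK : involutive flip.
    move=> X; apply/ffunP => i; rewrite !ffunE /upd ffunE /upd eqxx negbK.
    by case: eqP => [->|].
  have E X : mean e G (X : {ffun I -> bool}) = (G X + G (flip X)) / 2.
    have flipE : flip X = upd X e (~~ X e) :> (I -> bool).
      by apply/funext => i; rewrite /flip ffunE.
    have XE : upd X e (X e) = X.
      by apply/funext => i; rewrite /upd; case: eqP => [->|].
    have -> : G X = G (upd X e (X e)) by rewrite XE.
    by rewrite flipE /mean; case: (X e) => //=; rewrite addrC.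
  rewrite /avg; under eq_bigr do rewrite coinE E.
  under [RHS]eq_bigr do rewrite coinE.
  rewrite -!mulr_sumr -mulr_suml big_split /=.
  have -> : \sum_(X : {ffun I -> bool}) G (flip X) =
      \sum_(X : {ffun I -> bool}) G X.
    by rewrite [RHS](reindex_inj (inv_inj flipK)).
  by field.
have avg_foldr l G : avg (foldr (@mean R I) G l) = avg G.
  by elim: l => //= e l IHl; rewrite avg_mean.
have -> : iid_expectation (@fair_coin R) F = avg (fun X => F (finfun X)).
  by apply: eq_bigr => X _; congr (_ * F _); apply/ffunP => i; rewrite ffunE.
rewrite -(avg_foldr (enum I)) /avg.
under eq_bigr => X _.
  rewrite (@indep_const _ _ _ (enum I) X (fun=> false)); last first.
  - by move=> e; rewrite inE mem_enum.
  - by move=> e el; apply: indep_foldr; rewrite el.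
  rewrite prodr_const; over.
rewrite -/(expect _ _) sumr_const card_ffun card_bool -mulrnAl -mulr_natr natrX.
by rewrite -exprMn mul1r mulVf ?pnatr_eq0 // expr1n mul1r.
Qed.

End IidExpect.

(** * Values of greedy and optimal matchings *)

Lemma max_sub_itv (R : realDomainType) (a b c d x y : R) :
  x <= a - c <= y -> x <= b - d <= y ->
  x <= Num.max a b - Num.max c d <= y.
Proof.
move=> /andP[? ?] /andP[? ?].
by case: (leP a b) => ?; case: (leP c d) => ?; apply/andP; split; lra.
Qed.

Section MatchingValue.
Variables (R : realType) (E V : eqType) (src dst : E -> V).
Implicit Types (S : V -> bool) (l : seq E) (e : E) (w : E -> R).

Definition add S v : V -> bool := fun u => S u || (u == v).
Definition cover e S := add (add S (src e)) (dst e).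
Definition blocked S e := S (src e) || S (dst e).
Definition conflict e e' :=
  [|| src e == src e', src e == dst e', dst e == src e' | dst e == dst e'].

(* Total weight of the matching built greedily along l ([opt = false]), or
   maximum weight of a matching contained in l ([opt = true]), when the vertices
   in S are not available. *)
Fixpoint value (opt : bool) w l S : R :=
  if l is e :: l' then
    if blocked S e then value opt w l' S
    else let taken := w e + value opt w l' (cover e S) in
      if opt then Num.max (value opt w l' S) taken else taken
  else 0.

Lemma addC S u v : add (add S u) v = add (add S v) u.
Proof. by apply/funext => x; rewrite /add orbAC. Qed.

Lemma add_mem S v : S v -> add S v = S.
Proof.
by move=> Sv; apply/funext => x; rewrite /add; case: eqP => [->|]; rewrite ?Sv ?orbF.
Qed.

Lemma blocked_cover S e e' : blocked (cover e S) e' = blocked S e' || conflict e e'.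
Proof.
rewrite /blocked /cover /add /conflict !(eq_sym (src e')) !(eq_sym (dst e')).
by do 2 case: (S _); do 4 case: (_ == _).
Qed.

Lemma eq_value opt w w' l S : {in l, w =1 w'} -> value opt w l S = value opt w' l S.
Proof.
elim: l S => //= e l IHl S ww'; rewrite ww' ?mem_head //.
by rewrite !IHl // => x xl; apply: ww'; rewrite inE xl orbT.
Qed.

Lemma value_ext opt w l S S' :
  {in l, forall e, S (src e) = S' (src e) /\ S (dst e) = S' (dst e)} ->
  value opt w l S = value opt w l S'.
Proof.
elim: l S S' => //= e l IHl S S' SS'.
have [Ss Sd] := SS' _ (mem_head _ _).
have SS'l : {in l, forall e, S (src e) = S' (src e) /\ S (dst e) = S' (dst e)}.
  by move=> x xl; apply: SS'; rewrite inE xl orbT.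
rewrite /blocked Ss Sd (IHl _ _ SS'l) (IHl (cover e S) (cover e S')) //.
by move=> x xl; rewrite /cover /add; have [-> ->] := SS'l x xl.
Qed.

Definition heaviest_first w l := sorted (fun e e' => w e' <= w e) l.

Lemma heaviest_first_cons w e l : heaviest_first w (e :: l) ->
  heaviest_first w l /\ {in l, forall e', w e' <= w e}.
Proof.
move=> wl; split; first exact: path_sorted wl.
apply/allP; apply: order_path_min wl => y x z xy yz; exact: le_trans yz xy.
Qed.

(* Making v unavailable changes the greedy matching along an alternating path
   whose weights do not increase, hence the weight of only one edge is lost. *)
Lemma value_add opt w l S v (K : R) : 0 <= K -> heaviest_first w l ->
  {in l, forall e, 0 <= w e <= K} ->
  0 <= value opt w l S - value opt w l (add S v) <= K.
Proof.
move=> K0; elim: l S v K K0 => [|e l IHl] S v K K0; first by rewrite subrr lexx.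
move=> /heaviest_first_cons[wl wle] wK.
have /andP[we0 weK] := wK _ (mem_head _ _).
have wKl : {in l, forall e, 0 <= w e <= K}.
  by move=> x xl; apply: wK; rewrite inE xl orbT.
have wel : {in l, forall e', 0 <= w e' <= w e}.
  by move=> x xl; rewrite wle //; have /andP[->] := wKl _ xl.
have [Sv|Sv] := boolP (S v); first by rewrite add_mem // subrr lexx.
have IHK S' v' := IHl S' v' K K0 wl wKl.
have IHe S' v' := IHl S' v' (w e) we0 wl wel.
rewrite /=; have [Se|Se] := boolP (blocked S e).
  have -> : blocked (add S v) e.
    by move: Se; rewrite /blocked /add => /orP[] ->; rewrite ?orbT.
  exact: IHK.
(* The case where the lost vertex [u] is an end of [e] and [u'] is the other end. The remaining
   edges weigh at most [w e], so the induction hypothesis with bound [w e] puts [A - B] and [B - C]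
   in [[0, w e]], hence also [w e + C - B]. *)
have lost u u' : let A := value opt w l S in let B := value opt w l (add S u) in
    let C := value opt w l (add (add S u) u') in
    0 <= (if opt then Num.max A (w e + C) else w e + C) - B <= K.
  move=> A B C; have := IHe S u; have := IHe (add S u) u'; rewrite -/A -/B -/C.
  move=> /andP[h1 h2] /andP[h3 h4]; clear IHl IHK IHe.
  move: A B C h1 h2 h3 h4; case: opt => A B C h1 h2 h3 h4.
    by case: (leP A (w e + C)) => ?; apply/andP; split; lra.
  by apply/andP; split; lra.
have [->|sv] := eqVneq v (src e).
  by rewrite [blocked (add S (src e)) e]/blocked /add eqxx orbT /= lost.
have [->|dv] := eqVneq v (dst e).
  rewrite [blocked (add S (dst e)) e]/blocked /add eqxx !orbT /=.
  by rewrite /cover addC lost.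
have -> : blocked (add S v) e = false.
  move: Se; rewrite /blocked /add negb_or => /andP[/negbTE -> /negbTE ->].
  by rewrite !(eq_sym _ v) (negbTE sv) (negbTE dv).
have -> : cover e (add S v) = add (cover e S) v.
  by rewrite /cover [RHS]addC [add (add S _) v]addC.
have hS := IHK S v; have /andP[h1 h2] := IHK (cover e S) v.
have hT : 0 <= w e + value opt w l (cover e S) -
    (w e + value opt w l (add (cover e S) v)) <= K by apply/andP; split; lra.
by move: hS hT; clear; case: opt => // hS hT; apply: max_sub_itv.
Qed.

Lemma value_cover opt w l S e (K : R) : 0 <= K -> heaviest_first w l ->
  {in l, forall e, 0 <= w e <= K} ->
  0 <= value opt w l S - value opt w l (cover e S) <= 2 * K.
Proof.
move=> K0 wl wK; rewrite /cover.
have /andP[h1 h2] := value_add opt S (src e) K0 wl wK.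
have /andP[h3 h4] := value_add opt (add S (src e)) (dst e) K0 wl wK.
by apply/andP; split; lra.
Qed.

Lemma value_filter opt w l S (K : R) (p : pred E) : 0 <= K -> heaviest_first w l ->
  {in l, forall e, 0 <= w e <= K} ->
  `|value opt w l S - value opt w [seq e <- l | p e] S| <= 2 * K * (count (predC p) l)%:R.
Proof.
move=> K0; elim: l S => [|e l IHl] S; first by rewrite subrr normr0 mulr0.
move=> /heaviest_first_cons[wl wle] wK.
have /andP[we0 weK] := wK _ (mem_head _ _).
have wKl : {in l, forall e, 0 <= w e <= K}.
  by move=> x xl; apply: wK; rewrite inE xl orbT.
have {}IHl S' := IHl S' wl wKl.
rewrite /=; case pe: (p e) => /=; rewrite ?add0n.
  case: ifP => Se; first exact: IHl.
  have hS := IHl S; have := IHl (cover e S); rewrite ler_norml => /andP[h1 h2].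
  have hT : `|w e + value opt w l (cover e S) - (w e +
      value opt w [seq e <- l | p e] (cover e S))| <= 2 * K * (count (predC p) l)%:R.
    by rewrite ler_norml; apply/andP; split; lra.
  move: hS hT; clear; case: opt => // hS hT.
  by rewrite ler_norml max_sub_itv -?ler_norml.
have := IHl S; rewrite natrD mulrDr mulr1 !ler_norml => /andP[h1 h2].
case: ifP => Se; first by apply/andP; split; lra.
have /andP[h3 h4] := value_cover opt S e K0 wl wKl.
move: h1 h2 h3 h4 we0 weK; clear; case: opt => h1 h2 h3 h4 we0 weK.
  move: h1 h2 h3 h4.
  set A := value _ _ _ S; set B := value _ _ _ _; set C := value _ _ _ _.
  by case: (leP A (w e + C)) => ? *; apply/andP; split; lra.
by apply/andP; split; lra.
Qed.

Lemma value_blocks (L : eqType) (beta : V -> L) (Bs : seq L) opt w l S :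
  uniq Bs -> {in l, forall e, beta (src e) = beta (dst e) /\ beta (src e) \in Bs} ->
  value opt w l S = \sum_(B <- Bs) value opt w [seq e <- l | beta (src e) == B] S.
Proof.
move=> uBs; elim: l S => [|e l IHl] S Hl /=.
  by rewrite big1.
have [sd sB] := Hl _ (mem_head _ _).
have {}Hl : {in l, forall e, beta (src e) = beta (dst e) /\ beta (src e) \in Bs}.
  by move=> x xl; apply: Hl; rewrite inE xl orbT.
rewrite !IHl // !(bigD1_seq _ sB uBs) /= eqxx /=.
have -> : \sum_(B <- Bs | B != beta (src e))
    value opt w (if beta (src e) == B then e :: [seq x <- l | beta (src x) == B]
      else [seq x <- l | beta (src x) == B]) S =
    \sum_(B <- Bs | B != beta (src e)) value opt w [seq x <- l | beta (src x) == B] S.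
  by apply: eq_bigr => B; rewrite eq_sym => /negbTE ->.
case: ifP => Se //.
have -> : \sum_(B <- Bs | B != beta (src e))
      value opt w [seq x <- l | beta (src x) == B] (cover e S) =
    \sum_(B <- Bs | B != beta (src e)) value opt w [seq x <- l | beta (src x) == B] S.
  apply: eq_bigr => B Be; apply: value_ext => x.
  rewrite mem_filter => /andP[/eqP xB xl]; have [xsd _] := Hl _ xl.
  have ne v : beta v = B -> (v == src e) || (v == dst e) = false.
    move=> vB; apply/negP => /orP[] /eqP ve; move: Be; rewrite -vB ve ?sd eqxx //.
  by rewrite /cover /add -!orbA !ne ?orbF // -xsd.
case: opt {IHl} => /=; last by rewrite addrA.
by rewrite addrA -addr_maxl.
Qed.

Lemma value_le w l S (m : pred E) : {in l, forall e, 0 <= w e} ->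
  {in l, forall e, m e -> ~~ blocked S e} ->
  {in l &, forall e e', m e -> m e' -> conflict e e' -> e = e'} -> uniq l ->
  \sum_(e <- l | m e) w e <= value true w l S.
Proof.
elim: l S => [|e l IHl] S w0 mS mm; first by rewrite big_nil.
move=> /= /andP[el ul]; rewrite big_cons.
have w0l : {in l, forall e, 0 <= w e}.
  by move=> x xl; apply: w0; rewrite inE xl orbT.
have mSl : {in l, forall e, m e -> ~~ blocked S e}.
  by move=> x xl; apply: mS; rewrite inE xl orbT.
have mml : {in l &, forall e e', m e -> m e' -> conflict e e' -> e = e'}.
  by move=> x y xl yl; apply: mm; rewrite inE ?xl ?yl orbT.
have skip := IHl _ w0l mSl mml ul.
case: ifP => me; last first.
  by case: ifP => // _; rewrite le_max skip.
rewrite (negbTE (mS _ (mem_head _ _) me)) le_max lerD2l; apply/orP; right.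
apply: IHl => // x xl mx; rewrite blocked_cover negb_or mSl //=.
apply/negP => cx; move: el; rewrite (mm e x) ?xl ?mem_head //.
by rewrite inE xl orbT.
Qed.

(** For nonnegative weights, this and [value_le] identify [value true] with the maximum weight of a
    matching in [l] that avoids [S], matchings being predicates on edges. *)
Lemma value_attained w l S : uniq l -> exists m : pred E,
  [/\ {in l, forall e, m e -> ~~ blocked S e},
      {in l &, forall e e', m e -> m e' -> conflict e e' -> e = e'} &
      value true w l S = \sum_(e <- l | m e) w e].
Proof.
elim: l S => [|e l IHl] S.
  by exists xpred0; split => //=; rewrite big_nil.
move=> /= /andP[el ul].
have skip : exists m : pred E,
   [/\ {in e :: l, forall e, m e -> ~~ blocked S e},
      {in e :: l &, forall e e', m e -> m e' -> conflict e e' -> e = e'} &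
      value true w l S = \sum_(e <- e :: l | m e) w e].
  have [m [mS mm ->]] := IHl S ul.
  exists (fun x => (x != e) && m x); split.
  - by move=> x; rewrite inE => /orP[/eqP ->|xl /andP[_]]; [rewrite eqxx|exact: mS].
  - move=> x y; rewrite !inE => /orP[/eqP ->|xl]; first by rewrite eqxx.
    by move=> /orP[/eqP ->|yl]; [rewrite eqxx|move=> /andP[_ ?] /andP[_ ?]; apply: mm].
  - rewrite big_cons eqxx /= big_seq_cond [RHS]big_seq_cond; apply: eq_bigl => x.
    case xl: (x \in l) => //=; suff -> : x != e by [].
    by apply: contraNneq el => <-.
case: ifP => Se //.
case: leP => _; last by exact: skip.
have [m [mS mm ->]] := IHl (cover e S) ul.
exists (fun x => (x == e) || m x); split.
- move=> x; rewrite inE => /orP[/eqP ->|xl]; first by rewrite Se.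
  case/orP => [/eqP ->|mx]; first by rewrite Se.
  by have := mS _ xl mx; rewrite blocked_cover negb_or => /andP[].
- have mC x : x \in l -> m x -> conflict e x = false.
    by move=> xl mx; have := mS _ xl mx; rewrite blocked_cover negb_or => /andP[_ /negbTE].
  have confC x y : conflict x y = conflict y x.
    rewrite /conflict !(eq_sym (src y)) !(eq_sym (dst y)).
    by do 4 case: (_ == _).
  move=> x y; rewrite !inE.
  have [->|xe] := eqVneq x e; have [->|ye] := eqVneq y e => //= xl yl mx my.
  + by rewrite mC.
  + by rewrite confC mC.
  + exact: mm.
- rewrite big_cons eqxx /=; congr (_ + _).
  rewrite big_seq_cond [RHS]big_seq_cond; apply: eq_bigl => x.
  case xl: (x \in l) => //=; suff /negbTE -> : x != e by [].
  by apply: contraNneq el => <-.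
Qed.

(** The greedy matching is characterized by stability: every rejected edge is blocked from the start
    or meets an accepted edge that stands before it. This recognizes the output of Algorithm 1
    without following its iterations. *)
Lemma value_greedy w l S (m : pred E) : uniq l ->
  {in l, forall e, m e -> ~~ blocked S e} ->
  {in l &, forall e e', m e -> m e' -> conflict e e' -> e = e'} ->
  (forall l1 e l2, l = l1 ++ e :: l2 -> ~~ m e ->
     blocked S e || has (fun e' => m e' && conflict e' e) l1) ->
  value false w l S = \sum_(e <- l | m e) w e.
Proof.
elim: l S => [|e l IHl] S /=; first by rewrite big_nil.
move=> /andP[el ul] mS mm mE; rewrite big_cons.
have mSl : {in l, forall e, m e -> ~~ blocked S e}.
  by move=> x xl; apply: mS; rewrite inE xl orbT.
have mml : {in l &, forall e e', m e -> m e' -> conflict e e' -> e = e'}.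
  by move=> x y xl yl; apply: mm; rewrite inE ?xl ?yl orbT.
have [me|me] := boolP (m e).
  rewrite (negbTE (mS _ (mem_head _ _) me)); congr (_ + _); apply: IHl => //.
    move=> x xl mx; rewrite blocked_cover negb_or mSl //=.
    apply/negP => cx; move: el; rewrite (mm e x) ?xl ?mem_head //.
    by rewrite inE xl orbT.
  move=> l1 x l2 lE mx; rewrite blocked_cover -orbA.
  by have := mE (e :: l1) x l2; rewrite lE /= me => ->.
have := mE [::] e l erefl me; rewrite orbF => ->.
apply: IHl => // l1 x l2 lE mx.
by have := mE (e :: l1) x l2; rewrite lE /= (negbTE me) => ->.
Qed.

(** Half of the weight of each chosen edge is charged to each of its ends, and no vertex is charged
    twice. *)
Lemma value_cap opt w l S (Vs : seq V) (cap : V -> R) : uniq Vs ->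
  (forall v, 0 <= cap v) ->
  {in l, forall e, [/\ src e \in Vs, dst e \in Vs, src e != dst e,
     w e <= cap (src e) & w e <= cap (dst e)]} ->
  value opt w l S <= 2^-1 * \sum_(v <- Vs | ~~ S v) cap v.
Proof.
move=> uVs cap0; elim: l S => [|e l IHl] S Hl /=.
  by rewrite mulr_ge0 ?invr_ge0 ?ler0n // sumr_ge0.
have [sV dV sd ws wd] := Hl _ (mem_head _ _).
have {}IHl S' : value opt w l S' <= 2^-1 * \sum_(v <- Vs | ~~ S' v) cap v.
  by apply: IHl => x xl; apply: Hl; rewrite inE xl orbT.
case: ifP => Se //.
have taken : w e + value opt w l (cover e S) <= 2^-1 * \sum_(v <- Vs | ~~ S v) cap v.
  have := IHl (cover e S).
  move: Se; rewrite /blocked => /negbT; rewrite negb_or => /andP[Ss Sd].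
  suff -> : \sum_(v <- Vs | ~~ S v) cap v = cap (src e) + cap (dst e) +
      \sum_(v <- Vs | ~~ cover e S v) cap v by lra.
  rewrite (big_rem _ sV) /= Ss -addrA; congr (_ + _).
  have dV' : dst e \in rem (src e) Vs by rewrite mem_rem_uniq // !inE eq_sym sd.
  rewrite (big_rem _ dV') /= Sd; congr (_ + _).
  rewrite (big_rem _ sV) /= /cover /add eqxx orbT /= add0r.
  rewrite (big_rem _ dV') /= eqxx !orbT /= add0r.
  rewrite big_seq_cond [RHS]big_seq_cond; apply: eq_bigl => v.
  rewrite mem_rem_uniq ?rem_uniq // inE /= mem_rem_uniq // !inE.
  by case: (v == src e); case: (v == dst e); rewrite //= ?andbF ?orbF.
by case: opt IHl taken => IHl taken //; rewrite ge_max taken IHl.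
Qed.

End MatchingValue.

Lemma value_map (R : realType) (E V E' V' : eqType) (src dst : E -> V)
    (src' dst' : E' -> V') (f : E -> E') (g : V -> V') opt (w : E' -> R) l S :
  injective g -> (forall e, src' (f e) = g (src e)) ->
  (forall e, dst' (f e) = g (dst e)) ->
  value src' dst' opt w (map f l) S = value src dst opt (w \o f) l (S \o g).
Proof.
move=> g_inj srcf dstf; elim: l S => //= e l IHl S.
rewrite !IHl /blocked srcf dstf /=.
suff -> : cover src' dst' (f e) S \o g = cover src dst e (S \o g) by [].
by apply/funext => v; rewrite /cover /add /= srcf dstf !(inj_eq g_inj).
Qed.

(** * The grid and its blocks *)

(** The triple (r, d, c) is the edge from cell (r, c) to the cell below if [d] holds, and to the
    cell on the right otherwise. Rows and columns are numbered from 1, so that index 0 is outside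
    every grid and predecessors such as [r.-1] need no case distinction. *)
Definition uedge : Type := (nat * bool * nat)%type.

Definition usrc (e : uedge) : nat * nat := (e.1.1, e.2).
Definition udst (e : uedge) : nat * nat :=
  if e.1.2 then (e.1.1.+1, e.2) else (e.1.1, e.2.+1).

(** Even keys are the horizontal edges of a row, odd keys the vertical edges below it; ties are then
    broken by the column. *)
Definition ukey (e : uedge) : nat := (e.1.1.*2 + e.1.2)%N.
Definition ult (e e' : uedge) :=
  ((ukey e < ukey e') || (ukey e == ukey e') && (e.2 < e'.2))%N.
Definition ule (e e' : uedge) :=
  ((ukey e < ukey e') || (ukey e == ukey e') && (e.2 <= e'.2))%N.

Definition in_grid n (e : uedge) :=
  [&& 0 < e.1.1, 0 < e.2, e.1.1 + e.1.2 <= n & e.2 + ~~ e.1.2 <= n]%N.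

Definition ugrid n : seq uedge := sort ule
  ([seq (r, false, c) | r <- iota 1 n, c <- iota 1 n.-1] ++
   [seq (r, true, c) | r <- iota 1 n.-1, c <- iota 1 n]).

Lemma ukey_inj (e e' : uedge) : ukey e = ukey e' -> e.2 = e'.2 -> e = e'.
Proof.
move: e e' => [[r d] c] [[r' d'] c'] /=; rewrite /ukey /= => k ->.
by case: d k; case: d' => /= k; first [lia | have -> : r = r' by lia].
Qed.

Lemma ult_trans : transitive ult.
Proof. by move=> y x z; rewrite /ult => xy yz; apply/orP; lia. Qed.

Lemma ult_irr : irreflexive ult.
Proof. by move=> x; rewrite /ult !ltnn andbF. Qed.

Lemma mem_ugrid n e : (e \in ugrid n) = in_grid n e.
Proof.
rewrite mem_sort mem_cat; case: e => [[r d] c]; apply/idP/idP.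
  by case/orP=> /allpairsP[[r' c']] [/=]; rewrite !mem_iota => h1 h2 [-> -> ->];
    rewrite /in_grid /=; lia.
rewrite /in_grid /=; case: d => /and4P[r0 c0 rn cn]; apply/orP; [right|left];
  by apply/allpairsP; exists (r, c); split => //=; rewrite mem_iota; lia.
Qed.

Lemma ugrid_uniq n : uniq (ugrid n).
Proof.
rewrite sort_uniq cat_uniq !allpairs_uniq ?iota_uniq //=.
- rewrite andbT; apply/hasPn => e /allpairsP[[r c] /= [_ _ ->]].
  by apply/negP => /allpairsP[[r' c'] /= [_ _ []]].
- by move=> [r c] [r' c'] _ _ /= [-> ->].
- by move=> [r c] [r' c'] _ _ /= [-> ->].
Qed.

Lemma size_ugrid n : size (ugrid n) = (2 * (n * n.-1))%N.
Proof. by rewrite size_sort size_cat !size_allpairs !size_iota; lia. Qed.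

Lemma ugrid_sorted n : sorted ult (ugrid n).
Proof.
have : sorted ule (ugrid n) && uniq (ugrid n).
  by rewrite ugrid_uniq andbT; apply: sort_sorted => x y; rewrite /ule; apply/orP; lia.
elim: (ugrid n) => //= e [|e' l] IHl //= /andP[/andP[ee' el] /and3P[eNl e'l ul]].
have -> : path ult e' l by apply: IHl; rewrite /= el e'l.
rewrite andbT.
move: eNl; rewrite inE negb_or => /andP[eNe' _].
move: ee'; rewrite /ule /ult => /orP[-> //|/andP[k]]; rewrite leq_eqVlt.
case/orP => [/eqP c|->]; last by rewrite k orbT.
by move: eNe'; rewrite (ukey_inj (eqP k) c) eqxx.
Qed.

Definition shift a b (e : uedge) : uedge := ((e.1.1 + a)%N, e.1.2, (e.2 + b)%N).

Lemma shift_inj a b : injective (shift a b).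
Proof. by move=> [[r d] c] [[r' d'] c'] [] /addIn -> -> /addIn ->. Qed.

Definition block k (v : nat * nat) := (v.1.-1 %/ k, v.2.-1 %/ k)%N.

Definition inside k B (e : uedge) := (block k (usrc e) == B) && (block k (udst e) == B).

Lemma divn_itv (k i x : nat) : (0 < k)%N ->
  ((x %/ k == i) = (i * k <= x < i.+1 * k))%N.
Proof.
by move=> k0; rewrite -ltn_divLR // ltnS -leq_divRL // eqn_leq andbC.
Qed.

(** Both lists are strictly increasing for [ult], an order that shifts preserve, so it is enough to
    compare their members. *)
Lemma ugrid_block n k i j : (0 < k)%N -> (i.+1 * k <= n)%N -> (j.+1 * k <= n)%N ->
  [seq e <- ugrid n | inside k (i, j) e] = map (shift (i * k) (j * k)) (ugrid k).
Proof.
move=> k0 ik jk; apply: (irr_sorted_eq ult_trans ult_irr).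
- exact/sorted_filter/ugrid_sorted/ult_trans.
- rewrite sorted_map; apply: sub_sorted (ugrid_sorted k) => -[[r d] c] [[r' d'] c'].
  by rewrite /ult /ukey /= !doubleD; lia.
move=> -[[r d] c]; rewrite mem_filter mem_ugrid; apply/idP/mapP.
  move=> /andP[/andP[]]; rewrite /block /in_grid /= !xpair_eqE !divn_itv //.
  move: (i * k)%N (j * k)%N ik jk (mulSn i k) (mulSn j k) => a b ik jk -> -> .
  move=> sB dB gB; exists ((r - a)%N, d, (c - b)%N).
    by rewrite mem_ugrid /in_grid /=; case: d gB dB => /= gB dB; lia.
  by rewrite /shift /=; congr (_, _, _); lia.
move=> [[[r' d'] c']]; rewrite mem_ugrid /in_grid /= => gB [-> -> ->].
rewrite /inside /block /in_grid /= !xpair_eqE !divn_itv // !mulSn.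
rewrite !mulSn in ik jk.
by move: (i * k)%N (j * k)%N ik jk => a b ik jk; case: d' gB => /= gB; lia.
Qed.

Section GridValue.
Variables (R : realType) (Delta : R).
Hypothesis Delta0 : 0 < Delta.
Implicit Types (X : uedge -> bool) (l : seq uedge).

Definition heavy_first X l := [seq e <- l | X e] ++ [seq e <- l | ~~ X e].

Definition wt X (e : uedge) : R := two_values Delta (X e).

Definition gvalue opt l X : R :=
  value usrc udst opt (wt X) (heavy_first X l) (fun=> false).

Definition Egrid opt n : R := expect (ugrid n) (gvalue opt (ugrid n)).

Lemma wt_itv X e : 0 <= wt X e <= 1 + Delta.
Proof. by move: Delta0; rewrite /wt /two_values; case: (X e) => /= ?; apply/andP; split; lra. Qed.

Lemma heaviest_heavy_first X l : heaviest_first (wt X) (heavy_first X l).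
Proof.
rewrite /heaviest_first /heavy_first sorted_pairwise; last first.
  by move=> y x z xy yz; exact: le_trans yz xy.
rewrite pairwise_cat; apply/and3P; split.
- apply/allrelP => x y; rewrite !mem_filter => /andP[Xx _] /andP[Xy _].
  by move: Delta0; rewrite /wt Xx (negbTE Xy) /= => ?; lra.
- apply/(pairwiseP (0%N, true, 0%N)) => i j; rewrite !inE => il jl _.
  have := mem_nth (0%N, true, 0%N) il; have := mem_nth (0%N, true, 0%N) jl.
  by rewrite !mem_filter /wt => /andP[-> _] /andP[-> _].
- apply/(pairwiseP (0%N, true, 0%N)) => i j; rewrite !inE => il jl _.
  have := mem_nth (0%N, true, 0%N) il; have := mem_nth (0%N, true, 0%N) jl.
  by rewrite !mem_filter /wt => /andP[/negbTE -> _] /andP[/negbTE -> _].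
Qed.

Lemma mem_heavy_first X l : heavy_first X l =i l.
Proof. by move=> e; rewrite mem_cat !mem_filter -andb_orl orbN. Qed.

Lemma perm_heavy_first X l : perm_eq (heavy_first X l) l.
Proof. by rewrite /heavy_first perm_filterC. Qed.

Lemma heavy_first_filter X l (p : pred uedge) :
  [seq e <- heavy_first X l | p e] = heavy_first X [seq e <- l | p e].
Proof.
rewrite /heavy_first filter_cat -!filter_predI.
by congr (_ ++ _); apply: eq_filter => e /=; rewrite andbC.
Qed.

Lemma gvalue_shift opt a b l X :
  gvalue opt (map (shift a b) l) X = gvalue opt l (X \o shift a b).
Proof.
rewrite /gvalue /heavy_first !filter_map -map_cat.
rewrite (@value_map _ _ _ _ _ usrc udst usrc udst _
  (fun v => ((v.1 + a)%N, (v.2 + b)%N))) //.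
- by move=> [r c] [r' c'] [] /addIn -> /addIn ->.
- by move=> [[r [|]] c].
Qed.

Lemma gvalue_indep opt l e : e \notin l -> indep (gvalue opt l) e.
Proof.
move=> el X b; rewrite /gvalue.
have updE : {in l, upd X e b =1 X}.
  by move=> x xl; rewrite /upd; case: eqP => // xe; rewrite -xe xl in el.
have -> : heavy_first (upd X e b) l = heavy_first X l.
  by congr (_ ++ _); apply: eq_in_filter => x xl; rewrite updE.
by apply: eq_value => x; rewrite mem_heavy_first => xl; rewrite /wt updE.
Qed.

Lemma gvalue_blocks opt n k X (q := (n %/ k)%N) (K : R := 1 + Delta) : (0 < k)%N ->
  `|gvalue opt (ugrid n) X - \sum_(i < q) \sum_(j < q)
      gvalue opt (map (shift (i * k) (j * k)) (ugrid k)) X|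
  <= 2 * K * (2 * (n * n.-1) - q ^ 2 * (2 * (k * k.-1)))%:R.
Proof.
move=> k0; pose Bs := [seq (i, j) | i <- iota 0 q, j <- iota 0 q].
have uBs : uniq Bs by rewrite allpairs_uniq ?iota_uniq // => -[i j] [i' j'] _ _ [-> ->].
have BsP B : B \in Bs -> (B.1.+1 * k <= n)%N /\ (B.2.+1 * k <= n)%N.
  move=> /allpairsP[[i j] /= []]; rewrite !mem_iota !add0n /= => iq jq ->.
  by rewrite /= -!leq_divRL.
have sumBs (T : nmodType) (F : nat * nat -> T) :
    \sum_(B <- Bs) F B = \sum_(i < q) \sum_(j < q) F (val i, val j).
  rewrite big_allpairs -(big_mkord xpredT (fun i => \sum_(j < q) F (i, val j))).
  rewrite /index_iota subn0; apply: eq_bigr => i _.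
  by rewrite -(big_mkord xpredT (fun j => F (i, j))) /index_iota subn0.
(* The kept edges have both ends in one of the [q * q] complete blocks. All others are deleted at
   the price given by [value_filter]. *)
pose p (e : uedge) := (block k (usrc e) == block k (udst e)) && (block k (usrc e) \in Bs).
have blockE B : B \in Bs ->
    [seq e <- [seq e <- ugrid n | p e] | block k (usrc e) == B] =
    map (shift (B.1 * k) (B.2 * k)) (ugrid k).
  move=> BB; have [h1 h2] := BsP _ BB; rewrite -(ugrid_block k0 h1 h2) -filter_predI.
  apply: eq_filter => e; rewrite /= /inside /p -surjective_pairing.
  by case: eqP => //= ->; rewrite BB andbT eq_sym.
have Kpos : 0 <= K by rewrite addr_ge0 ?ltW.
have := value_filter usrc udst opt (fun=> false) p Kpos (heaviest_heavy_first X (ugrid n))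
  (fun e _ => wt_itv X e).
have -> : value usrc udst opt (wt X) [seq e <- heavy_first X (ugrid n) | p e] (fun=> false)
    = \sum_(i < q) \sum_(j < q) gvalue opt (map (shift (i * k) (j * k)) (ugrid k)) X.
  rewrite heavy_first_filter (value_blocks (beta := block k) _ _ _ uBs); last first.
    move=> e; rewrite mem_heavy_first mem_filter => /andP[/andP[/eqP <- ->] _].
    by [].
  rewrite -(sumBs _ (fun B => gvalue opt (map (shift (B.1 * k) (B.2 * k)) (ugrid k)) X)).
  rewrite big_seq [RHS]big_seq; apply: eq_bigr => B BB.
  by rewrite heavy_first_filter blockE.
suff -> : count (predC p) (heavy_first X (ugrid n)) =
  (2 * (n * n.-1) - q ^ 2 * (2 * (k * k.-1)))%N by [].
rewrite (permP (perm_heavy_first X (ugrid n))) -size_ugrid -(count_predC p (ugrid n)).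
suff -> : count p (ugrid n) = (q ^ 2 * (2 * (k * k.-1)))%N by rewrite addKn.
rewrite -size_filter -sum1_size.
(* Each kept edge lies in exactly one block, so exchanging the two sums counts the edges of a k x k
   grid once per block. *)
have -> : (\sum_(e <- [seq e <- ugrid n | p e]) 1 =
    \sum_(e <- [seq e <- ugrid n | p e]) \sum_(B <- Bs | block k (usrc e) == B) 1)%N.
  rewrite big_seq [RHS]big_seq; apply: eq_bigr => e.
  rewrite mem_filter => /andP[/andP[_ eB] _].
  by rewrite sum1_count (eq_count (a2 := pred1 (block k (usrc e)))) ?count_uniq_mem ?eB.
rewrite (exchange_big_dep xpredT) //=.
have -> : (\sum_(B <- Bs) \sum_(e <- [seq e <- ugrid n | p e] | block k (usrc e) == B) 1 =
   \sum_(B <- Bs) 2 * (k * k.-1))%N.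
  rewrite big_seq [RHS]big_seq; apply: eq_bigr => B BB.
  by rewrite -big_filter blockE // sum1_size size_map size_ugrid.
by rewrite big_const_seq count_predT size_allpairs !size_iota iter_addn_0 mulnC mulnn.
Qed.

End GridValue.

(** * The matching built by Algorithm 1 *)

Section GreedyStable.
Variables (V : finType) (adj : rel V) (R : realDomainType) (idx : V -> nat).
Hypotheses (adjC : symmetric adj) (idx_inj : injective idx).
Variable W : edge adj -> R.
Implicit Types (M : {set edge adj}) (v x y z : V) (e : edge adj).

Definition prefers v z y :=
  (weight W v y < weight W v z) ||
  (weight W v y == weight W v z) && (idx z <= idx y)%N.

Lemma prefers_anti v y z : prefers v y z -> prefers v z y -> y = z.
Proof.
rewrite /prefers => /orP[vz|/andP[/eqP vz yz]] /orP[vy|/andP[/eqP vy zy]].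
- by have := lt_trans vz vy; rewrite ltxx.
- by rewrite vy ltxx in vz.
- by rewrite vz ltxx in vy.
- by apply: idx_inj; apply/eqP; rewrite eqn_leq yz zy.
Qed.

Lemma proposes_prefers M x y z :
  proposes idx W M x y -> unmatched M z -> adj x z -> prefers x y z.
Proof.
move=> /and4P[_ _ _ /forallP /(_ z) /implyP H] uz xz.
by have := H; rewrite uz xz; apply.
Qed.

Lemma unmatchedPn M x : ~~ unmatched M x -> exists2 e, e \in M & x \in val e.
Proof. by rewrite negb_forall_in => /exists_inP[e eM /negPn]; exists e. Qed.

Lemma unmatched_notin M x e : unmatched M x -> x \in val e -> e \notin M.
Proof. by move=> /forall_inP ux xe; apply/negP => /ux; rewrite xe. Qed.

Lemma greedy_step_new M e v : e \in greedy_step idx W M -> e \notin M -> v \in val e ->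
  exists2 z, val e = [set v; z] & proposes idx W M v z.
Proof.
rewrite !inE => /orP[-> //|/existsP[x /existsP[y /and3P[/eqP eE xy yx]]] _].
rewrite eE !inE => /orP[] /eqP ->; first by exists y.
by exists x => //; rewrite finset.setUC.
Qed.

(** A new edge joins two vertices that were unmatched, so it avoids the old edges. Two new edges
    cannot meet either, because a vertex proposes only to its favorite neighbor, which is unique
    since the indices are distinct. *)
Lemma greedy_matching : is_matching (greedy idx W).
Proof.
rewrite /greedy; elim: #|V| => [|k IHk].
  by apply/forall_inP => e; rewrite inE.
rewrite iterS; move: (iter _ _ _) IHk => M mM.
have olddisj e v z : e \in M -> proposes idx W M v z -> [disjoint val e & [set v; z]].
  move=> eM /and4P[uv uz _ _]; rewrite disjoint_sym finset.disjoints_subset.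
  apply/fintype.subsetP => x; rewrite !inE => /orP[] /eqP -> ; apply/negP => xe;
    by move: eM; apply/negP; apply: unmatched_notin xe.
apply/forall_inP => e eM; apply/forall_inP => e' e'M; apply/implyP => ee'.
have [eo|en] := boolP (e \in M); have [eo'|en'] := boolP (e' \in M).
- by have /forall_inP/(_ _ eo)/forall_inP/(_ _ eo')/implyP := mM; apply.
- have /finset.set0Pn[v ve'] : val e' != finset.set0.
    move: (valP e'); rewrite inE => /existsP[x /existsP[y /andP[_ /eqP ->]]].
    by apply/finset.set0Pn; exists x; rewrite !inE eqxx.
  by have [z -> vz] := greedy_step_new e'M en' ve'; apply: olddisj.
- have /finset.set0Pn[v ve] : val e != finset.set0.
    move: (valP e); rewrite inE => /existsP[x /existsP[y /andP[_ /eqP ->]]].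
    by apply/finset.set0Pn; exists x; rewrite !inE eqxx.
  by have [z -> vz] := greedy_step_new eM en ve; rewrite disjoint_sym; apply: olddisj.
- apply: contraNT ee'; rewrite -finset.setI_eq0 => /finset.set0Pn[v]; rewrite inE => /andP[ve ve'].
  have [z eE vz] := greedy_step_new eM en ve.
  have [z' eE' vz'] := greedy_step_new e'M en' ve'.
  have /and4P[_ uz az _] := vz; have /and4P[_ uz' az' _] := vz'.
  apply/eqP/val_inj; rewrite eE eE'; congr [set _; _].
  exact: prefers_anti (proposes_prefers vz uz' az') (proposes_prefers vz' uz az).
Qed.

(** Consider the first iteration that matches an end [v] of the edge. The other end [o] was still
    available, so [v] ranks its partner [z] at least as high as [o]. Such an iteration exists
    because the algorithm stops only when no two neighbors are both unmatched. *)
Lemma greedy_stable x y : adj x y -> exists2 e, e \in greedy idx W &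
  exists v z o, [/\ (v, o) \in [:: (x, y); (y, x)], val e = [set v; z], adj v z &
    prefers v z o].
Proof.
move=> axy; pose P M := exists2 e, e \in M &
  exists v z o, [/\ (v, o) \in [:: (x, y); (y, x)], val e = [set v; z], adj v z &
    prefers v z o].
have : (unmatched (greedy idx W) x && unmatched (greedy idx W) y) \/ P (greedy idx W).
  rewrite /greedy; elim: #|V| => [|k IHk].
    by left; apply/andP; split; apply/forall_inP => e; rewrite inE.
  rewrite iterS; move: (iter _ _ _) IHk => M [/andP[ux uy]|[e eM Pe]]; last first.
    by right; exists e => //; rewrite inE eM.
  have [ux'|/unmatchedPn[e eM' xe]] := boolP (unmatched (greedy_step idx W M) x).
    have [uy'|/unmatchedPn[e eM' ye]] := boolP (unmatched (greedy_step idx W M) y).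
      by left.
    right; exists e => //.
    have [z eE yz] := greedy_step_new eM' (unmatched_notin uy ye) ye.
    exists y, z, x; split=> //; first by rewrite !inE eqxx orbT.
      by case/and4P: yz.
    by apply: proposes_prefers yz ux _; rewrite adjC.
  right; exists e => //.
  have [z eE xz] := greedy_step_new eM' (unmatched_notin ux xe) xe.
  exists x, z, y; split=> //; first by rewrite !inE eqxx.
    by case/and4P: xz.
  exact: proposes_prefers xz uy axy.
case=> // /andP[ux uy]; have := greedy_stopped idx W adjC.
by move=> /existsPn/(_ x)/existsPn/(_ y); rewrite ux uy axy.
Qed.

End GreedyStable.

(** * Correspondence between the edges of the finite grid and the triples of [ugrid n] *)

Section GridLink.
Variable n : nat.
Local Notation I := (grid_edge n).
Implicit Types (x : uedge) (y z v : cell n) (e : I).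

Definition pos y : nat * nat := (y.1.+1, y.2.+1).

Definition ends x : {set cell n} := [set y | (pos y == usrc x) || (pos y == udst x)].

(** The search always succeeds, by [uofP], so the default value of [nth] is never returned. *)
Definition uof e : uedge :=
  let s := ugrid n in nth (0%N, true, 0%N) s (find (fun x => val e == ends x) s).

Lemma pos_inj : injective pos.
Proof.
by move=> [a b] [a' b'] [/= h1 h2]; congr (_, _); apply: val_inj.
Qed.

Lemma grid_adjC : symmetric (@grid_adj n).
Proof.
by move=> x y; rewrite /grid_adj ![x.1 == _]eq_sym ![x.2 == _]eq_sym;
  congr (_ && _ || _ && _); rewrite orbC.
Qed.

Lemma cell_idx_inj : injective (@cell_idx n).
Proof.
move=> [[a an] [b bn]] [[a' an'] [b' bn']]; rewrite /cell_idx /= => E.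
suff [aE bE] : a = a' /\ b = b' by congr (_, _); apply: val_inj.
have aE : a = a' by nia.
by split=> //; move: E; rewrite aE => /addnI.
Qed.

Lemma cell_idx_lt y z : (cell_idx y < cell_idx z)%N ->
  (y.1 < z.1)%N || (y.1 == z.1 :> nat) && (y.2 < z.2)%N.
Proof.
move: y z => [[a an] [b bn]] [[a' an'] [b' bn']]; rewrite /cell_idx /= => E.
by case: (ltngtP a a') => //= aa'; nia.
Qed.

Lemma adj_uedge y z : grid_adj y z -> exists2 x, x \in ugrid n &
  (usrc x = pos y /\ udst x = pos z) \/ (usrc x = pos z /\ udst x = pos y).
Proof.
case: y z => [[a an] [b bn]] [[a' an'] [b' bn']].
rewrite /grid_adj /pos /= -!val_eqE /= => /orP[] /andP[/eqP -> /orP[] /eqP E].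
- by exists (a'.+1, false, b.+1); rewrite ?mem_ugrid /in_grid /= ?E; [lia|left].
- by exists (a'.+1, false, b'.+1); rewrite ?mem_ugrid /in_grid /= ?E; [lia|right].
- by exists (a.+1, true, b'.+1); rewrite ?mem_ugrid /in_grid /= ?E; [lia|left].
- by exists (a'.+1, true, b'.+1); rewrite ?mem_ugrid /in_grid /= ?E; [lia|right].
Qed.

Lemma uedge_adj x : x \in ugrid n -> exists y z,
  [/\ grid_adj y z, pos y = usrc x & pos z = udst x].
Proof.
rewrite mem_ugrid; case: x => [[[|r] [|]] [|c]] //; rewrite /in_grid /= => /andP[h1 h2].
  have [rn rn' cn] : [/\ r < n, r.+1 < n & c < n]%N by split; lia.
  exists (Ordinal rn, Ordinal cn), (Ordinal rn', Ordinal cn).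
  by rewrite /grid_adj /pos /= !eqxx orbT.
have [rn cn cn'] : [/\ r < n, c < n & c.+1 < n]%N by split; lia.
exists (Ordinal rn, Ordinal cn), (Ordinal rn, Ordinal cn').
by rewrite /grid_adj /pos /= !eqxx.
Qed.

Lemma endsE x y z : pos y = usrc x -> pos z = udst x -> ends x = [set y; z].
Proof. by move=> yx zx; apply/setP => v; rewrite !inE -yx -zx !(inj_eq pos_inj). Qed.

Lemma ends_inj : {in ugrid n &, injective ends}.
Proof.
move=> x x' xg x'g E.
have [y [z [_ yx zx]]] := uedge_adj xg; have [y' [z' [_ yx' zx']]] := uedge_adj x'g.
move: E; rewrite (endsE yx zx) (endsE yx' zx') => /setP E.
have := E y; have := E z; rewrite !inE !eqxx orbT /= -!(inj_eq pos_inj) yx zx yx' zx'.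
move: x x' {xg x'g yx zx yx' zx' E} => [[r d] c] [[r' d'] c'].
rewrite /usrc /udst /=; case: d; case: d' => /=; rewrite !xpair_eqE;
  move=> /esym/orP h1 /esym/orP h2; by congr (_, _, _); lia.
Qed.

Lemma uofP e : uof e \in ugrid n /\ val e = ends (uof e).
Proof.
have He : has (fun x => val e == ends x) (ugrid n).
  move: (valP e); rewrite inE => /existsP[y /existsP[z /andP[/adj_uedge[x xg xyz] /eqP eE]]].
  apply/hasP; exists x => //; rewrite eE.
  case: xyz => [] [sx dx]; first by rewrite -(endsE (esym sx) (esym dx)).
  by rewrite finset.setUC -(endsE (esym sx) (esym dx)).
by split; [rewrite mem_nth // -has_find | apply/eqP/(nth_find _ He)].
Qed.

Lemma uof_inj : injective uof.
Proof. by move=> e e' E; apply: val_inj; rewrite !(uofP _).2 E. Qed.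

Lemma uof_surj x : x \in ugrid n -> exists e, uof e = x.
Proof.
move=> xg; have [y [z [yz yx zx]]] := uedge_adj xg.
have ex : ends x \in edges (@grid_adj n).
  rewrite inE; apply/existsP; exists y; apply/existsP; exists z.
  by rewrite yz (endsE yx zx) eqxx.
exists (exist _ (ends x) ex); apply: ends_inj; rewrite ?(uofP _).1 //.
by rewrite -(uofP _).2.
Qed.

Lemma perm_uof : perm_eq (map uof (enum I)) (ugrid n).
Proof.
apply: uniq_perm; rewrite ?ugrid_uniq ?(map_inj_uniq uof_inj) ?enum_uniq // => x.
apply/mapP/idP => [[e _ ->]|xg]; first exact: (uofP e).1.
by have [e <-] := uof_surj xg; exists e; rewrite ?mem_enum.
Qed.

Lemma disjoint_conflict e e' :
  [disjoint val e & val e'] = ~~ conflict usrc udst (uof e) (uof e').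
Proof.
have [y [z [_ yx zx]]] := uedge_adj (uofP e).1.
have [y' [z' [_ yx' zx']]] := uedge_adj (uofP e').1.
rewrite !(uofP _).2 (endsE yx zx) (endsE yx' zx') /conflict -yx -zx -yx' -zx'.
rewrite !(inj_eq pos_inj) -finset.setI_eq0; apply/idP/idP.
  apply: contraL => H; apply/finset.set0Pn.
  case/or4P: H => /eqP E; [exists y|exists y|exists z|exists z];
    by rewrite !inE E !eqxx ?orbT.
apply: contraNT => /finset.set0Pn[v]; rewrite !inE.
by case/andP => /orP[] /eqP -> /orP[] ->; rewrite ?orbT.
Qed.

Lemma sum_uof (R : realType) (P : pred I) (w : uedge -> R) (m : pred uedge) :
  (forall e, m (uof e) = P e) ->
  \sum_(e | P e) w (uof e) = \sum_(x <- ugrid n | m x) w x.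
Proof.
move=> mP; rewrite -(perm_big _ perm_uof) /= big_map big_enum_cond /=.
by apply: eq_bigl => e; rewrite mP.
Qed.

End GridLink.

(** * Algorithm 1 and the optimal matching as values along the ordered list of edges *)

Section ValueLink.
Variables (R : realType) (Delta : R) (n : nat).
Hypothesis Delta0 : 0 < Delta.
Local Notation I := (grid_edge n).
Local Notation ends := (@ends n).
Implicit Types (X : uedge -> bool) (x : uedge) (y z v : cell n) (e : I).

Definition ugreedy X : {set I} :=
  greedy (@cell_idx n) (fun e : I => wt Delta X (uof e)).

Definition umatched X x := [exists e, (e \in ugreedy X) && (uof e == x)].

Definition before X x' x := (X x' && ~~ X x) || (X x' == X x) && ult x' x.

Lemma umatched_uof X e : umatched X (uof e) = (e \in ugreedy X).
Proof.
apply/existsP/idP => [[e' /andP[eM /eqP/uof_inj <-]]//|eM].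
by exists e; rewrite eM eqxx.
Qed.

Lemma umatched_grid X x : umatched X x -> x \in ugrid n.
Proof. by move=> /existsP[e /andP[_ /eqP <-]]; exact: (uofP e).1. Qed.

Lemma umatched_conflict X x x' : umatched X x -> umatched X x' ->
  conflict usrc udst x x' -> x = x'.
Proof.
move=> /existsP[e /andP[eM /eqP <-]] /existsP[e' /andP[eM' /eqP <-]] H.
congr uof; apply/eqP; apply: contraTT H => ee'.
rewrite -disjoint_conflict; have := greedy_matching (@cell_idx_inj n)
  (fun e : I => wt Delta X (uof e)).
by move=> /forall_inP/(_ _ eM)/forall_inP/(_ _ eM')/implyP; apply.
Qed.

Lemma before_trans X : transitive (before X).
Proof.
move=> y x z; rewrite /before; case: (X x); case: (X y); case: (X z) => //=;
  exact: ult_trans.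
Qed.

Lemma before_irr X : irreflexive (before X).
Proof. by move=> x; rewrite /before ult_irr andbF orbF andbN. Qed.

Lemma weight_uof X x y z : x \in ugrid n -> ends x = [set y; z] ->
  weight (fun e : I => wt Delta X (uof e)) y z = wt Delta X x.
Proof.
move=> /uof_surj[e <-] E; rewrite /weight -E -(uofP e).2.
by rewrite valK.
Qed.

Lemma wt_lt X x x' : (wt Delta X x < wt Delta X x') = X x' && ~~ X x.
Proof.
rewrite /wt /two_values; case: (X x); case: (X x'); rewrite ?ltxx //=.
  by rewrite ltNge lerDl ltW.
by rewrite ltrDl.
Qed.

Lemma wt_eq X x x' : (wt Delta X x == wt Delta X x') = (X x == X x').
Proof.
by rewrite eq_le !leNgt !wt_lt; case: (X x); case: (X x').
Qed.

(** By increasing index, the neighbors of a cell are those above, on the left, on the right and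
    below. The edges to them come in the same order for [ult], so the tie-breaking rule of the
    algorithm agrees with the processing order. *)
Lemma ult_ends x x' y z v : x \in ugrid n -> x' \in ugrid n ->
  ends x = [set v; y] -> ends x' = [set v; z] -> grid_adj v y -> grid_adj v z ->
  y != z -> (cell_idx z <= cell_idx y)%N -> ult x' x.
Proof.
move=> xg xg' xE xE' vy vz yz; rewrite leq_eqVlt => /orP[/eqP/cell_idx_inj E|].
  by rewrite E eqxx in yz.
move=> /cell_idx_lt zy.
have [a ag aE] := adj_uedge vy; have [b bg bE] := adj_uedge vz.
have {a ag aE} : (usrc x = pos v /\ udst x = pos y) \/ (usrc x = pos y /\ udst x = pos v).
  suff -> : x = a by [].
  apply: (@ends_inj n) => //; rewrite xE.
  case: aE => [] [sa da]; first by rewrite (endsE (esym sa) (esym da)).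
  by rewrite (endsE (esym sa) (esym da)) finset.setUC.
have {b bg bE} : (usrc x' = pos v /\ udst x' = pos z) \/ (usrc x' = pos z /\ udst x' = pos v).
  suff -> : x' = b by [].
  apply: (@ends_inj n) => //; rewrite xE'.
  case: bE => [] [sa da]; first by rewrite (endsE (esym sa) (esym da)).
  by rewrite (endsE (esym sa) (esym da)) finset.setUC.
move: v y z x x' zy {xg xg' xE xE' vy vz yz} =>
  [v1 v2] [y1 y2] [z1 z2] [[r [|]] c] [[r' [|]] c'];
  rewrite /usrc /udst /pos /ult /ukey /= => zy;
  by case=> -[[E1 E2] [E3 E4]]; case=> -[[F1 F2] [F3 F4]]; lia.
Qed.

Lemma umatched_stable X x : x \in ugrid n -> ~~ umatched X x ->
  exists2 x', umatched X x' & conflict usrc udst x' x && before X x' x.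
Proof.
move=> xg nx; have [y [z [yz yx zx]]] := uedge_adj xg.
have [e eM [v [u [t [voE eE vu pr]]]]] := greedy_stable (@cell_idx n) (@grid_adjC n)
  (fun e : I => wt Delta X (uof e)) yz.
have mE : umatched X (uof e) by rewrite umatched_uof.
exists (uof e) => //.
have xE : ends x = [set v; t].
  rewrite (endsE yx zx); move: voE; rewrite !inE => /orP[] /eqP [-> ->] //.
  by rewrite finset.setUC.
have vo : grid_adj v t.
  by move: voE; rewrite !inE => /orP[] /eqP [-> ->] //; rewrite grid_adjC.
have eE' : ends (uof e) = [set v; u] by rewrite -(uofP e).2.
have eg := (uofP e).1.
have ou : t != u.
  by apply: contraNneq nx => ou; rewrite -(_ : uof e = x) //;
    apply: (@ends_inj n); rewrite // eE' xE ou.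
apply/andP; split.
  have [ex xeE] := uof_surj xg; rewrite -xeE -[conflict _ _ _ _]negbK.
  rewrite -disjoint_conflict -finset.setI_eq0; apply/finset.set0Pn; exists v.
  by rewrite inE eE (uofP ex).2 xeE xE !inE eqxx.
move: pr; rewrite /prefers (weight_uof X xg xE) (weight_uof X eg eE').
rewrite wt_lt wt_eq /before [X x == _]eq_sym => /orP[->//|/andP[-> /= idx_le]].
by rewrite (ult_ends xg eg xE eE') // orbT.
Qed.

Lemma fstar_gvalue X :
  fstar (fun e : I => wt Delta X (uof e)) = gvalue Delta true (ugrid n) X.
Proof.
have wt0 x : 0 <= wt Delta X x by case/andP: (wt_itv Delta0 X x).
have ul : uniq (heavy_first X (ugrid n)).
  by rewrite (perm_uniq (perm_heavy_first X _)) ugrid_uniq.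
have memP e : uof e \in heavy_first X (ugrid n).
  by rewrite mem_heavy_first; exact: (uofP e).1.
have sumE (M : {set I}) (m : pred uedge) : (forall e, m (uof e) = (e \in M)) ->
    total_weight (fun e : I => wt Delta X (uof e)) M =
    \sum_(x <- heavy_first X (ugrid n) | m x) wt Delta X x.
  by move=> mM; rewrite /total_weight (sum_uof _ mM) (perm_big _ (perm_heavy_first X _)).
apply/eqP; rewrite eq_le; apply/andP; split.
  apply/bigmax_leP; split.
    have := @value_le R _ _ usrc udst (wt Delta X) (heavy_first X (ugrid n)) (fun=> false)
      xpred0; rewrite big_pred0_eq; apply=> // *; exact: wt0.
  move=> M /forall_inP mM.
  rewrite (sumE M [pred x | [exists e, (e \in M) && (uof e == x)]]); last first.
    move=> e /=; apply/existsP/idP => [[e' /andP[eM /eqP/uof_inj <-]]//|eM].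
    by exists e; rewrite eM eqxx.
  apply: value_le => // x x' _ _ /=.
  move=> /existsP[e /andP[eM /eqP <-]] /existsP[e' /andP[eM' /eqP <-]] H.
  congr uof; apply/eqP; apply: contraTT H => ee'.
  by rewrite -disjoint_conflict; have /forall_inP/(_ _ eM')/implyP := mM _ eM; apply.
have [m [_ mm mE]] := value_attained usrc udst (wt Delta X) (fun=> false) ul.
rewrite /gvalue mE -(sumE [set e | m (uof e)]); last by move=> e; rewrite inE.
apply: le_bigmax_cond; apply/forall_inP => e; rewrite inE => me.
apply/forall_inP => e'; rewrite inE => me'; apply/implyP.
rewrite disjoint_conflict; apply: contraNN => H.
by apply/eqP/uof_inj; apply: mm.
Qed.

Lemma fhat_umatched X : fhat (@cell_idx n) (fun e : I => wt Delta X (uof e)) =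
  \sum_(x <- ugrid n | umatched X x) wt Delta X x.
Proof. by apply: sum_uof => e; rewrite umatched_uof. Qed.

(** The list is strictly sorted by [before], so the blocking edge found by [umatched_stable] really
    stands to the left of the unmatched edge, as [value_greedy] requires. *)
Lemma fhat_gvalue X :
  fhat (@cell_idx n) (fun e : I => wt Delta X (uof e)) = gvalue Delta false (ugrid n) X.
Proof.
have ul : uniq (heavy_first X (ugrid n)).
  by rewrite (perm_uniq (perm_heavy_first X _)) ugrid_uniq.
have srt : sorted (before X) (heavy_first X (ugrid n)).
  have sub (p : pred uedge) : pairwise ult [seq x <- ugrid n | p x].
    by rewrite -(sorted_pairwise ult_trans); apply: sorted_filter; [exact: ult_trans|exact: ugrid_sorted].
  rewrite sorted_pairwise; last exact: before_trans.
  rewrite pairwise_cat; apply/and3P; split.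
  - apply/allrelP => x y; rewrite !mem_filter /before => /andP[-> _] /andP[/negbTE -> _].
    by [].
  - apply: (sub_in_pairwise (P := X)) (sub X); last exact: filter_all.
    by move=> x y Xx Xy; rewrite /before (Xx : X x) (Xy : X y).
  - apply: (sub_in_pairwise (P := predC X)) (sub (predC X)); last exact: filter_all.
    by move=> x y Xx Xy; rewrite /before (negbTE (Xx : ~~ X x)) (negbTE (Xy : ~~ X y)).
rewrite fhat_umatched /gvalue (@value_greedy _ _ _ _ _ _ _ _ (umatched X)) //; last 2 first.
- by move=> x x' _ _; exact: umatched_conflict.
- move=> l1 x l2 lE nx; apply/orP; right; apply/hasP.
  have xg : x \in ugrid n by rewrite -(mem_heavy_first X) lE mem_cat mem_head orbT.
  have [x' mx' /andP[cx' bx']] := umatched_stable xg nx.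
  exists x'; last by rewrite mx'.
  have := umatched_grid mx'; rewrite -(mem_heavy_first X (ugrid n)) lE mem_cat inE.
  case/or3P => // [/eqP x'x|x'l2].
    by rewrite x'x before_irr in bx'.
  move: srt; rewrite lE sorted_pairwise; last exact: before_trans.
  rewrite pairwise_cat /= => /and4P[_ _ /allP/(_ _ x'l2) xx' _].
  by have := before_trans bx' xx'; rewrite before_irr.
by rewrite (perm_big _ (perm_heavy_first X _)).
Qed.

End ValueLink.

Lemma expected_weightE (R : realType) (Delta : R) n (f : (grid_edge n -> R) -> R) :
  expected_weight Delta f =
  expect (ugrid n) (fun X => f (fun e => wt Delta X (uof e))).
Proof.
rewrite /expected_weight iid_expectation_expect.
pose F (X : grid_edge n -> bool) := f (fun e => two_values Delta (finfun X e)).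
rewrite -(expect_map _ F (@uof_inj n)).
rewrite -(@expect_sub _ _ (map (@uof n) (enum (grid_edge n))) (ugrid n)).
- by apply: eq_expect => X; congr f; apply/funext => e; rewrite ffunE.
- by move=> x; rewrite (perm_mem (perm_uof n)).
- by move=> x xg; rewrite (perm_mem (perm_uof n)) xg.
Qed.

(** * Upper bound on the optimal weight *)

Section UpperBound.
Variables (R : realType) (Delta : R).
Hypothesis Delta0 : 0 < Delta.
Implicit Types (X : uedge -> bool).

Lemma expect_none (l s : seq uedge) : uniq s -> {subset s <= l} ->
  expect l (fun X => (~~ has X s)%:R) = 2^-1 ^+ size s :> R.
Proof.
elim: s => [|e s IHs]; first by rewrite (eq_expect _ (G := fun=> 1)) ?expect_const.
move=> /= /andP[es us] sl; rewrite exprS -IHs //; last first.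
  by move=> x xs; apply: sl; rewrite inE xs orbT.
rewrite -expectZ -(@expect_mean _ _ e); last by apply: sl; rewrite mem_head.
apply: eq_expect => X; rewrite /mean /upd /= eqxx /= add0r mulrC.
congr (_ * (~~ _)%:R); apply: eq_in_has => x xs.
by case: eqP => // xe; rewrite -xe xs in es.
Qed.

Definition incident n v := [seq e <- ugrid n | (usrc e == v) || (udst e == v)].

Lemma size_incident n v : (size (incident n v) <= 4)%N.
Proof.
case: v => r c.
pose s := [:: (r, false, c); (r, true, c); (r, false, c.-1); (r.-1, true, c)].
apply: (@uniq_leq_size _ _ s); first by rewrite filter_uniq // ugrid_uniq.
move=> [[r' d] c']; rewrite mem_filter /usrc /udst /= => /andP[+ _].
rewrite !inE; case: d => /orP[] /eqP [<- <-]; rewrite /= ?eqxx ?orbT //.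
Qed.

Lemma Egrid_upper opt n :
  Egrid Delta opt n <= (n ^ 2)%:R * (2^-1 * (1 + 15 / 16 * Delta)).
Proof.
pose Vs := [seq (r, c) | r <- iota 1 n, c <- iota 1 n].
(* This is [1 + Delta] if some edge at [v] is heavy, and 1 otherwise. *)
pose cap X v : R := 1 + Delta * (1 - (~~ has X (incident n v))%:R).
have cap0 X v : 0 <= cap X v.
  by rewrite addr_ge0 // mulr_ge0 ?(ltW Delta0) // subr_ge0 lern1 leq_b1.
have le_cap X e v : e \in incident n v -> wt Delta X e <= cap X v.
  move=> ev; rewrite /wt /two_values; case: ifP => Xe.
    suff -> : cap X v = 1 + Delta by [].
    rewrite /cap (_ : has X _ = true) ?subr0 ?mulr1 //.
    by apply/hasP; exists e.
  by rewrite lerDl mulr_ge0 ?(ltW Delta0) // subr_ge0 lern1 leq_b1.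
have uVs : uniq Vs by rewrite allpairs_uniq ?iota_uniq // => -[i j] [i' j'] _ _ [-> ->].
have -> : (n ^ 2)%:R * (2^-1 * (1 + 15 / 16 * Delta)) =
    2^-1 * \sum_(v <- Vs) (1 + Delta * (15 / 16)).
  rewrite big_const_seq count_predT size_allpairs !size_iota iter_addr_0.
  by rewrite -mulnn -[in RHS]mulr_natl; field.
apply: (@le_trans _ _ (2^-1 * \sum_(v <- Vs) expect (ugrid n) (cap^~ v))).
  rewrite -(expect_sum Vs xpredT (ugrid n) (fun v X => cap X v)) -expectZ; apply: ler_expect => X.
  apply: (@value_cap _ _ _ usrc udst opt _ _ (fun=> false) _ _ uVs (cap0 X)) => e.
  rewrite mem_heavy_first => eg; have := eg; rewrite mem_ugrid => egr.
  have inc v : (usrc e == v) || (udst e == v) -> e \in incident n v.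
    by move=> ev; rewrite mem_filter ev.
  split; last 2 first.
  - by apply: le_cap; apply: inc; rewrite eqxx.
  - by apply: le_cap; apply: inc; rewrite eqxx orbT.
  - move: egr; case: e {eg inc} => [[r d] c]; rewrite /in_grid /usrc /= => h.
    by apply/allpairsP; exists (r, c); split; rewrite ?mem_iota //=; case: d h => /=; lia.
  - move: egr; case: e {eg inc} => [[r [|]] c]; rewrite /in_grid /udst /= => h.
      by apply/allpairsP; exists (r.+1, c); split; rewrite ?mem_iota //=; lia.
    by apply/allpairsP; exists (r, c.+1); split; rewrite ?mem_iota //=; lia.
  - case: e {eg egr inc} => [[r [|]] c]; rewrite /usrc /udst /= xpair_eqE; lia.
rewrite ler_pM2l ?invr_gt0 ?ltr0n //; apply: ler_sum => v _.
rewrite /cap expectD expect_const lerD2l expectZ ler_pM2l //.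
rewrite expectB expect_const expect_none; last 2 first.
- by rewrite filter_uniq // ugrid_uniq.
- by move=> e; rewrite mem_filter => /andP[].
(* With at most four edges at [v], all of them are light with probability at least 1/16; vertices on
   the border only make this probability larger. *)
have : 2^-1 ^+ 4 <= 2^-1 ^+ size (incident n v) :> R.
  by rewrite ler_wiXn2l ?size_incident // ?invr_ge0 ?invf_le1 ?ler1n ?ltr0n.
rewrite (_ : 2^-1 ^+ 4 = 1 / 16 :> R); last by field.
lra.
Qed.

End UpperBound.

(** * Certificates on the row automaton *)

Section Certificate.

Inductive quad (T : Type) := Quad of T & T & T & T.

Definition qget T (q : quad T) (s : bool * bool) : T :=
  let: Quad a b c d := q in
  match s with
  | (false, false) => a | (false, true) => b
  | (true, false) => c | (true, true) => d
  end.

Definition qof T (f : bool * bool -> T) : quad T :=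
  Quad (f (false, false)) (f (false, true)) (f (true, false)) (f (true, true)).

(* A table of integers indexed by the states of h consecutive rows. *)
Fixpoint table (h : nat) : Type := if h is h'.+1 then quad (table h') else N.

Fixpoint look (h : nat) (st : nat -> bool * bool) : table h -> N :=
  match h with
  | 0 => id
  | h'.+1 => fun t => look (fun j => st j.+1) (qget t (st 0%N))
  end.

Fixpoint tmap (f : N -> N) (h : nat) : table h -> table h :=
  match h with
  | 0 => f
  | h'.+1 => fun t => let: Quad a b c d := t in
      Quad (tmap f a) (tmap f b) (tmap f c) (tmap f d)
  end.

Fixpoint tmap2 (f : N -> N -> N) (h : nat) : table h -> table h -> table h :=
  match h with
  | 0 => f
  | h'.+1 => fun t u =>
      let: Quad a b c d := t in let: Quad a' b' c' d' := u in
      Quad (tmap2 f a a') (tmap2 f b b') (tmap2 f c c') (tmap2 f d d')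
  end.

Fixpoint tall2 (p : N -> N -> bool) (h : nat) : table h -> table h -> bool :=
  match h with
  | 0 => p
  | h'.+1 => fun t u =>
      let: Quad a b c d := t in let: Quad a' b' c' d' := u in
      [&& tall2 p a a', tall2 p b b', tall2 p c c' & tall2 p d d']
  end.

Fixpoint tconst (z : N) (h : nat) : table h :=
  if h is h'.+1 then let t := tconst z h' in Quad t t t t else z.

(* One row, read from left to right. The state (y, p) before reading column c:
   y says that the cell in column c - 1 can be heavily matched to the right, p
   that the cell in column c - 2 looks for a light match to the right. The input
   (u, d) comes from the row above: u says that the cell in column c is heavily
   matched upwards, d that the cell above column c - 1 looks for a light match
   downwards. The coins b1, b2 are those of the edges to the right of and below
   column c - 1. The output is the input of the row below when it reads column
   c - 1; the last component says whether an edge, or a heavy edge, is matched. *)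
Definition row_step (s x : bool * bool) (b1 b2 : bool) :
    (bool * bool) * (bool * bool) * (bool * bool) :=
  let: (y, p) := s in let: (u, d) := x in
  if y then
    if ~~ u && b1 then ((false, false), (false, p), (true, true))
    else if b2 then ((~~ u, false), (true, p), (true, true))
    else if d then ((~~ u, false), (false, p), (true, false))
    else if p then ((~~ u, false), (false, false), (true, false))
    else ((~~ u, true), (false, false), (false, false))
  else ((~~ u, false), (false, p), (false, false)).

Variables (heavy : bool) (unit : N).

Definition reward (r : bool * bool) : N :=
  if (if heavy then r.2 else r.1) then unit else 0%num.

(** The output [x'] of the row just read becomes the input of the row below. The reward is counted
    only if no row remains below, that is if [h] is 0. *)
Definition branch h (G : quad (quad (table h))) s x b1 b2 : table h :=
  let: (s', x', r) := row_step s x b1 b2 in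
  let t := qget (qget G s') x' in
  if h is 0 then tmap (N.add (reward r)) t else t.

(* [look st (qget (sweep V) x)] is 4 ^ h times the mean, over the 2 h coins, of
   the reward in the last row plus the value V of the next states, when the first
   row receives x. *)
Fixpoint sweep (h : nat) : table h -> quad (table h) :=
  match h with
  | 0 => fun V => Quad V V V V
  | h'.+1 => fun V => let: Quad a b c d := V in
      let G := Quad (sweep a) (sweep b) (sweep c) (sweep d) in
      qof (fun x => qof (fun s =>
        tmap2 N.add
          (tmap2 N.add (branch G s x true true) (branch G s x true false))
          (tmap2 N.add (branch G s x false true) (branch G s x false false))))
  end.

Definition tmin h (q : quad (table h)) : table h :=
  let: Quad a b c d := q in
  tmap2 N.min (tmap2 N.min a b) (tmap2 N.min c d).

Fixpoint scale h : N := if h is h'.+1 then N.mul 4 (scale h') else 1%num.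

(** The factor [scale h], equal to [4 ^ h], clears the denominators of the mean over the coins, so
    the check takes place among integers. The minimum over the input of the first row is the move of
    the adversary. *)
Definition certificate h (kappa : N) (V : table h) : bool :=
  tall2 (fun a b => N.leb (N.mul (scale h) (N.add a kappa)) b)
    V (tmin (sweep V)).

(** One damped step of value iteration: the old value is averaged with the updated one. Rounding
    down is harmless, since only the final table has to pass [certificate]. *)
Definition improve h (V : table h) : table h :=
  tmap2 (fun a b => N.div2 (N.add a (N.div b (scale h))))
    V (tmin (sweep V)).

Lemma look_tmap f h st (t : table h) : look st (tmap f t) = f (look st t).
Proof.
elim: h st t => //= h IHh st [a b c d].
by case: (st 0%N) => [[|] [|]] /=; rewrite IHh.
Qed.

Lemma look_tmap2 f h st (t u : table h) :
  look st (tmap2 f t u) = f (look st t) (look st u).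
Proof.
elim: h st t u => //= h IHh st [a b c d] [a' b' c' d'].
by case: (st 0%N) => [[|] [|]] /=; rewrite IHh.
Qed.

Lemma tall2P p h st (t u : table h) : tall2 p t u -> p (look st t) (look st u).
Proof.
elim: h st t u => //= h IHh st [a b c d] [a' b' c' d'] /and4P[ha hb hc hd].
by case: (st 0%N) => [[|] [|]] /=; apply: IHh.
Qed.

Lemma look_bounded h (t : table h) : exists B : nat, forall st,
  (N.to_nat (look st t) <= B)%N.
Proof.
elim: h t => [|h IHh] t; first by exists (N.to_nat t).
case: t => a b c d; have [A HA] := IHh a; have [B HB] := IHh b.
have [C HC] := IHh c; have [D HD] := IHh d.
exists (A + B + C + D)%N => st /=.
case: (st 0%N) => [[|] [|]] /=; [have := HD|have := HC|have := HB|have := HA];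
  by move=> /(_ (fun j => st j.+1)); lia.
Qed.

Lemma sweepS h (V : table h.+1) s x :
  qget (qget (sweep V) x) s =
  let G := qof (fun s => sweep (qget V s)) in
  tmap2 N.add
    (tmap2 N.add (branch G s x true true) (branch G s x true false))
    (tmap2 N.add (branch G s x false true) (branch G s x false false)).
Proof. by case: V => a b c d; case: x => [[|] [|]]; case: s => [[|] [|]]. Qed.

Lemma branchE h (V : table h.+1) s x b1 b2 st :
  let: (s', x', r) := row_step s x b1 b2 in
  look st (branch (qof (fun s => sweep (qget V s))) s x b1 b2) =
  N.add (if h is 0 then reward r else 0%num)
    (look st (qget (sweep (qget V s')) x')).
Proof.
rewrite /branch; case: (row_step _ _ _ _) => [[s' x'] r].
have -> : qget (qof (fun s => sweep (qget V s))) s' = sweep (qget V s').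
  by case: s' => [[|] [|]].
by case: h V st => [|h] V st //; rewrite look_tmap.
Qed.

Lemma certificateP h kappa (V : table h) : certificate kappa V -> forall st x,
  (4 ^ h * (N.to_nat (look st V) + N.to_nat kappa) <=
   N.to_nat (look st (qget (sweep V) x)))%N.
Proof.
move=> cV st x; have := tall2P st cV => /N.leb_spec0.
have le_min : N.le (look st (tmin (sweep V))) (look st (qget (sweep V) x)).
  rewrite /tmin; case: (sweep V) => a b c d; rewrite !look_tmap2.
  set A := look st a; set B := look st b; set C := look st c; set D := look st d.
  have h1 := N.le_min_l (N.min A B) (N.min C D).
  have h2 := N.le_min_r (N.min A B) (N.min C D).
  case: x => [[|] [|]] /=.
  - exact: N.le_trans h2 (N.le_min_r _ _).
  - exact: N.le_trans h2 (N.le_min_l _ _).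
  - exact: N.le_trans h1 (N.le_min_r _ _).
  - exact: N.le_trans h1 (N.le_min_l _ _).
move=> /N.le_trans/(_ le_min).
have -> : (4 ^ h)%N = N.to_nat (scale h).
  elim: h {V st x cV le_min} => // h IHh.
  by rewrite (_ : scale h.+1 = N.mul 4 (scale h)) // N2Nat.inj_mul -IHh expnS.
lia.
Qed.

End Certificate.

(** A matched edge counts for 10000 units here and for 1000 units in [heavy_table], so that 4607 and
    349 stand for 0.4607 and 0.349 edge per column. *)
Definition total_table := iter 17 (@improve false 10000 5) (tconst 0 5).
Definition heavy_table := iter 5 (@improve true 1000 2) (tconst 0 2).

Lemma total_certificate : certificate false 10000 4607 total_table.
Proof. by vm_compute. Qed.

Lemma heavy_certificate : certificate true 1000 349 heavy_table.
Proof. by vm_compute. Qed.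

(** * The greedy matching read row by row *)

Section RowAutomaton.
Variables (R : realType) (Delta : R) (n : nat).
Hypothesis Delta0 : 0 < Delta.
Implicit Types (X : uedge -> bool) (x : uedge) (r c : nat).
Local Notation m := (umatched Delta n).

Definition heavyH X r c := X (r, false, c) && m X (r, false, c).
Definition heavyV X r c := X (r, true, c) && m X (r, true, c).
Definition lightH X r c := ~~ X (r, false, c) && m X (r, false, c).
Definition lightV X r c := ~~ X (r, true, c) && m X (r, true, c).

Definition left_over X r c :=
  [&& ~~ heavyH X r c, ~~ heavyH X r c.-1, ~~ heavyV X r c & ~~ heavyV X r.-1 c].

(** In both cases the first three edges precede [x] in [ult] and the last three follow it. *)
Definition neighbors x : seq uedge :=
  let: (r, d, c) := x in
  if d then [:: (r.-1, true, c); (r, false, c.-1); (r, false, c);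
                (r.+1, false, c.-1); (r.+1, false, c); (r.+1, true, c)]
  else [:: (r.-1, true, c); (r, false, c.-1); (r.-1, true, c.+1);
           (r, true, c); (r, false, c.+1); (r, true, c.+1)].

Lemma mem_neighbors x x' : (0 < x'.1.1)%N -> (0 < x'.2)%N ->
  conflict usrc udst x' x -> x' != x -> x' \in neighbors x.
Proof.
move: x x' => [[r [|]] c] [[r' [|]] c'] /= r0 c0; rewrite /conflict /usrc /udst /=;
  rewrite !xpair_eqE !inE !xpair_eqE /= ?andbF ?andbT ?orbF ?orbT; lia.
Qed.

Lemma neighbors_conflict x x' : (0 < x.1.1)%N -> (0 < x.2)%N ->
  x' \in neighbors x -> conflict usrc udst x' x.
Proof.
move: x x' => [[r [|]] c] [[r' [|]] c'] /= r0 c0; rewrite /conflict /usrc /udst /=;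
  rewrite !xpair_eqE !inE !xpair_eqE /= ?andbF ?andbT ?orbF ?orbT; lia.
Qed.

(** One direction is the matching property. The other is stability: an unmatched edge meets a
    matched one that comes before it, and this one is among its neighbors. The matching thus becomes
    a local recursion along [before]. *)
Lemma umatchedE X x : m X x =
  (x \in ugrid n) && all (fun x' => ~~ (before X x' x && m X x')) (neighbors x).
Proof.
apply/idP/idP => [mx|/andP[xg /allP Hx]].
  have xg := umatched_grid mx; rewrite xg /=; apply/allP => x' xx'.
  apply/negP => /andP[bx mx'].
  move: xg; rewrite mem_ugrid => /and4P[r0 c0 _ _].
  have E := umatched_conflict mx' mx (neighbors_conflict r0 c0 xx').
  by rewrite E before_irr in bx.
apply: contraT => nx; have [x' mx' /andP[cx bx]] := umatched_stable Delta0 xg nx.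
have := umatched_grid mx'; rewrite mem_ugrid => /and4P[r0 c0 _ _].
have /Hx : x' \in neighbors x.
  by apply: mem_neighbors => //; apply: contraTneq bx => ->; rewrite before_irr.
by rewrite bx mx'.
Qed.

Lemma matchedE X x : m X x = (X x && m X x) || (~~ X x && m X x).
Proof. by case: (X x); rewrite ?orbF. Qed.

Lemma before_heavy X x x' : X x -> before X x' x = X x' && ult x' x.
Proof. by move=> Xx; rewrite /before Xx andbF; case: (X x'). Qed.

Lemma before_light X x x' : ~~ X x -> before X x' x = X x' || ult x' x.
Proof. by move=> /negbTE Xx; rewrite /before Xx andbT; case: (X x'). Qed.

Lemma ult_neighborsH r c : (0 < r)%N -> (0 < c)%N ->
  map (ult^~ (r, false, c)) (neighbors (r, false, c)) =
  [:: true; true; true; false; false; false].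
Proof. by move=> r0 c0 /=; do 6 (congr cons; first by rewrite /ult /ukey /=; lia). Qed.

Lemma ult_neighborsV r c : (0 < r)%N -> (0 < c)%N ->
  map (ult^~ (r, true, c)) (neighbors (r, true, c)) =
  [:: true; true; true; false; false; false].
Proof. by move=> r0 c0 /=; do 6 (congr cons; first by rewrite /ult /ukey /=; lia). Qed.

(** Only heavy edges that are smaller for [ult] come before a heavy edge, which leaves the first
    three neighbors. *)
Lemma heavyHE X r c : heavyH X r c = [&& X (r, false, c), (r, false, c) \in ugrid n,
  ~~ heavyV X r.-1 c, ~~ heavyV X r.-1 c.+1 & ~~ heavyH X r c.-1].
Proof.
rewrite {1}/heavyH umatchedE /heavyV /heavyH; case Xx: (X _) => //=.
case xg: (_ \in _) => //=; move: xg; rewrite mem_ugrid => /and4P[/= r0 c0 _ _].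
have [u1 u2 u3 u4 u5 u6] := ult_neighborsH r0 c0.
rewrite !before_heavy // u1 u2 u3 u4 u5 u6 !andbT !andbF /= andbT.
by case: (X _ && _); case: (X _ && _); case: (X _ && _).
Qed.

Lemma heavyVE X r c : heavyV X r c = [&& X (r, true, c), (r, true, c) \in ugrid n,
  ~~ heavyV X r.-1 c, ~~ heavyH X r c.-1 & ~~ heavyH X r c].
Proof.
rewrite {1}/heavyV umatchedE /heavyV /heavyH; case Xx: (X _) => //=.
case xg: (_ \in _) => //=; move: xg; rewrite mem_ugrid => /and4P[/= r0 c0 _ _].
have [u1 u2 u3 u4 u5 u6] := ult_neighborsV r0 c0.
by rewrite !before_heavy // u1 u2 u3 u4 u5 u6 !andbT !andbF /= andbT.
Qed.

(** All heavy edges come before a light one, so each of the six neighbors blocks it if heavily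
    matched, which [left_over] at both ends expresses; the first three block it also if lightly
    matched. *)
Lemma lightHE X r c : lightH X r c = [&& (r, false, c) \in ugrid n,
  left_over X r c, left_over X r c.+1, ~~ lightV X r.-1 c, ~~ lightV X r.-1 c.+1 &
  ~~ lightH X r c.-1].
Proof.
have H := heavyHE X r c.
(* If the edge itself is heavy, the right-hand side has to fail: either the edge is matched or a
   heavy matched edge blocks it, and in both cases an end is not left over. *)
rewrite /left_over /= {1}/lightH; case Xx: (X _) => /=.
  move: H; rewrite Xx /=; case: (_ \in _) => //= ->.
  case: (heavyV X r.-1 c) => //=; first by rewrite !andbF.
  case: (heavyV X r.-1 c.+1) => //=; first by rewrite !andbF.
  by case: (heavyH X r c.-1) => //=; rewrite ?andbF.
have -> : heavyH X r c = false by rewrite /heavyH Xx.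
rewrite umatchedE; case xg: (_ \in _) => //=.
move: xg; rewrite mem_ugrid => /and4P[/= r0 c0 _ _].
have [u1 u2 u3 u4 u5 u6] := ult_neighborsH r0 c0.
rewrite !before_light ?Xx // u1 u2 u3 u4 u5 u6 !orbT !orbF !andTb.
rewrite (matchedE X (r.-1, true, c)) (matchedE X (r, false, c.-1)).
rewrite (matchedE X (r.-1, true, c.+1)).
rewrite -/(heavyV X r.-1 c) -/(heavyV X r.-1 c.+1) -/(heavyV X r c) -/(heavyV X r c.+1).
rewrite -/(heavyH X r c.-1) -/(heavyH X r c.+1) -/(lightV X r.-1 c).
rewrite -/(lightV X r.-1 c.+1) -/(lightH X r c.-1) /= andbT.
do 4 (case: (heavyV _ _ _) => //=; rewrite ?andbF //).
do 2 (case: (heavyH _ _ _) => //=; rewrite ?andbF //);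
do 2 (case: (lightV _ _ _) => //=; rewrite ?andbF //).
by case: (lightH _ _ _).
Qed.

Lemma lightVE X r c : lightV X r c = [&& (r, true, c) \in ugrid n,
  left_over X r c, left_over X r.+1 c, ~~ lightV X r.-1 c, ~~ lightH X r c.-1 &
  ~~ lightH X r c].
Proof.
have H := heavyVE X r c.
rewrite /left_over /= {1}/lightV; case Xx: (X _) => /=.
  move: H; rewrite Xx /=; case: (_ \in _) => //= ->.
  case: (heavyV X r.-1 c) => //=; first by rewrite !andbF.
  case: (heavyH X r c.-1) => //=; first by rewrite !andbF.
  by case: (heavyH X r c) => //=; rewrite ?andbF.
have -> : heavyV X r c = false by rewrite /heavyV Xx.
rewrite umatchedE; case xg: (_ \in _) => //=.
move: xg; rewrite mem_ugrid => /and4P[/= r0 c0 _ _].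
have [u1 u2 u3 u4 u5 u6] := ult_neighborsV r0 c0.
rewrite !before_light ?Xx // u1 u2 u3 u4 u5 u6 !orbT !orbF !andTb.
rewrite (matchedE X (r.-1, true, c)) (matchedE X (r, false, c.-1)).
rewrite (matchedE X (r, false, c)).
rewrite -/(heavyV X r.-1 c) -/(heavyH X r.+1 c.-1) -/(heavyH X r.+1 c).
rewrite -/(heavyH X r c.-1) -/(heavyH X r c) -/(heavyV X r.+1 c).
rewrite -/(lightV X r.-1 c) -/(lightH X r c.-1) -/(lightH X r c) /= andbT.
do 2 (case: (heavyV _ _ _) => //=; rewrite ?andbF //).
do 4 (case: (heavyH _ _ _) => //=; rewrite ?andbF //).
by case: (lightV _ _ _) => //=; do 2 case: (lightH _ _ _).
Qed.


(** In the terms of [row_step], [state X r c] and [input X r c] are those for reading column c +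
    3. *)
Definition state X r c : bool * bool :=
  (~~ heavyV X r.-1 c.+2 && ~~ heavyH X r c.+1,
   [&& left_over X r c.+1, ~~ lightV X r.-1 c.+1 & ~~ lightH X r c]).

Definition demand X r c :=
  [&& left_over X r c, ~~ lightV X r.-1 c, ~~ lightH X r c.-1 & ~~ lightH X r c].

Definition input X r c : bool * bool := (heavyV X r.-1 c.+3, demand X r.-1 c.+2).

(** These are the edges decided at this step. A light vertical edge is credited to the row of its
    lower cell, since it is matched only if that cell is left over too. *)
Definition matched_now X r c : bool * bool :=
  (heavyH X r c.+2 || heavyV X r c.+2 || lightV X r.-1 c.+2 || lightH X r c.+1,
   heavyH X r c.+2 || heavyV X r c.+2).

(** The bounds on [r] and [c] put all edges involved in the grid. The local rules then express both
    sides by seven bits, and a truth table concludes. *)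
Lemma row_stepE X r c : (1 < r < n)%N -> (0 < c)%N -> (c.+2 < n)%N ->
  row_step (state X r c) (input X r c) (X (r, false, c.+2)) (X (r, true, c.+2)) =
  (state X r c.+1, input X r.+1 c.-1, matched_now X r c).
Proof.
move=> /andP[r1 rn] c0 cn; rewrite /state /input /matched_now /= prednK //.
have gH : (r, false, c.+2) \in ugrid n by rewrite mem_ugrid /in_grid /=; lia.
have gV : (r, true, c.+2) \in ugrid n by rewrite mem_ugrid /in_grid /=; lia.
have gLV : (r.-1, true, c.+2) \in ugrid n by rewrite mem_ugrid /in_grid /=; lia.
have gLH : (r, false, c.+1) \in ugrid n by rewrite mem_ugrid /in_grid /=; lia.
have rE : r.-1.+1 = r by lia.
have dV : lightV X r.-1 c.+2 = demand X r.-1 c.+2 && left_over X r c.+2.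
  rewrite lightVE gLV /demand rE; case: (left_over X r.-1 c.+2) => //=.
  by case: (left_over X r c.+2); rewrite ?andbT ?andbF.
have dH : demand X r c.+1 = [&& left_over X r c.+1, ~~ lightV X r.-1 c.+1 &
    ~~ lightH X r c] && ~~ lightH X r c.+1 by rewrite /demand -!andbA.
have lH : lightH X r c.+1 = [&& [&& left_over X r c.+1, ~~ lightV X r.-1 c.+1 &
    ~~ lightH X r c], left_over X r c.+2 & ~~ lightV X r.-1 c.+2].
  rewrite lightHE gLH [c.+1.-1]/=; case: (left_over X r c.+1) => //.
  case: (left_over X r c.+2); last by rewrite !andbF.
  by case: (lightV X r.-1 c.+1); case: (lightV X r.-1 c.+2); case: (lightH X r c).
pose p := [&& left_over X r c.+1, ~~ lightV X r.-1 c.+1 & ~~ lightH X r c].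
rewrite -/p in dH lH *; rewrite dH lH dV; clearbody p; clear dH lH dV.
move: (demand X r.-1 c.+2) => D.
have -> : left_over X r c.+2 = [&& ~~ heavyH X r c.+2, ~~ heavyH X r c.+1,
  ~~ heavyV X r c.+2 & ~~ heavyV X r.-1 c.+2] by [].
rewrite (heavyVE X r c.+2) gV (heavyHE X r c.+2) gH /=.
move: (X (r, false, c.+2)) (X (r, true, c.+2)) => b1 b2.
move: (heavyV X r.-1 c.+2) (heavyV X r.-1 c.+3) (heavyH X r c.+1) => u v w.
by case: u; case: w; case: v; case: b1; case: b2; case: D; case: p.
Qed.

End RowAutomaton.

(** * Freshness of the coins that an automaton reads *)

Section Locality.
Variables (R : realType) (Delta : R) (n : nat).
Hypothesis Delta0 : 0 < Delta.
Implicit Types (X Y : uedge -> bool) (r c : nat).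
Local Notation heavyH := (heavyH Delta n).
Local Notation heavyV := (heavyV Delta n).
Local Notation lightH := (lightH Delta n).
Local Notation lightV := (lightV Delta n).

(* The order in which the cells are read by the automata of consecutive rows, each
   row being one column behind the row above it. *)
Definition earlier r c r0 c0 :=
  ((r + c < r0 + c0) || (r + c == r0 + c0) && (r < r0))%N.

Lemma matched_off X d r c : ((r == 0) || (c == 0))%N -> umatched Delta n X (r, d, c) = false.
Proof.
move=> rc; apply: contraTF rc => /umatched_grid; rewrite mem_ugrid /in_grid /=.
by case: r => //; case: c => //; case: d.
Qed.

(** Induction on the antidiagonal r + c, then on the row: the rules at a cell refer to earlier
    antidiagonals and to the cell above on the same one. Light edges are treated one row or one
    column behind, because their status also depends on the heavy edges at their far end. *)
Lemma matched_local X Y r0 c0 :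
  (forall d r c, (r, c) != (r0, c0) -> X (r, d, c) = Y (r, d, c)) ->
  forall r c, earlier r c r0 c0 ->
  [/\ heavyH X r c = heavyH Y r c, heavyV X r c = heavyV Y r c,
      lightV X r.-1 c = lightV Y r.-1 c & lightH X r c.-1 = lightH Y r c.-1].
Proof.
move=> XY r c; move E: (r + c)%N => s.
elim/ltn_ind: s r c E => s IHs r; elim: r => [|r IHr] c E rc.
  by rewrite /heavyH /heavyV /lightH /lightV !matched_off ?andbF ?eqxx.
case: c E rc => [|c] E rc.
  by rewrite /heavyH /heavyV /lightH /lightV !matched_off ?andbF ?eqxx ?orbT.
have cellE d : X (r.+1, d, c.+1) = Y (r.+1, d, c.+1).
  by apply: XY; rewrite xpair_eqE; move: rc; rewrite /earlier; lia.
have past r' c' : (r' + c' < s)%N ->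
    [/\ heavyH X r' c' = heavyH Y r' c', heavyV X r' c' = heavyV Y r' c',
      lightV X r'.-1 c' = lightV Y r'.-1 c' & lightH X r' c'.-1 = lightH Y r' c'.-1].
  by move=> h; apply: (IHs _ h) => //; move: rc; rewrite /earlier; lia.
have [a1 a2 a3 [a4 a5 a6]] : [/\ (r + c.+1 < s)%N, (r.+1 + c < s)%N, (r + c < s)%N &
    [/\ (r.+1 + c.-1 < s)%N, (r.-1 + c.+1 < s)%N & (r + c.+2 = s)%N]].
  by clear -E; do 2?split; lia.
have rc2 : earlier r c.+2 r0 c0 by clear -rc E; move: rc; rewrite /earlier; lia.
have [H1 H2 H3 H4] : [/\ heavyH X r c.+2 = heavyH Y r c.+2,
    heavyV X r c.+2 = heavyV Y r c.+2, lightV X r.-1 c.+2 = lightV Y r.-1 c.+2 &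
    lightH X r c.+1 = lightH Y r c.+1].
  exact: IHr.
have [A1 A2 A3 A4] := past r c.+1 a1.
have [B1 B2 B3 B4] := past r.+1 c a2.
have [C1 C2 _ _] := past r c a3.
have [D1 _ _ _] := past r.+1 c.-1 a4.
have [_ E2 _ _] := past r.-1 c.+1 a5.
have hH : heavyH X r.+1 c.+1 = heavyH Y r.+1 c.+1.
  by rewrite [LHS]heavyHE // [RHS]heavyHE // cellE /= A2 H2 B1.
have hV : heavyV X r.+1 c.+1 = heavyV Y r.+1 c.+1.
  by rewrite [LHS]heavyVE // [RHS]heavyVE // cellE /= A2 B1 hH.
have lV : lightV X r c.+1 = lightV Y r c.+1.
  rewrite [LHS]lightVE // [RHS]lightVE // /left_over /= A1 A2 A3 A4 C1 E2 hH hV B1 H4.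
  by [].
split=> //=; rewrite [LHS]lightHE // [RHS]lightHE // /left_over /=.
by rewrite B1 B2 C2 D1 hH hV A2 B3 lV B4.
Qed.

Variables (r0 c0 : nat) (d : bool).
Local Notation e := (r0, d, c0).

Lemma upd_other X b d' r c : (r, c) != (r0, c0) -> upd X e b (r, d', c) = X (r, d', c).
Proof.
by move=> H; rewrite /upd; case: eqP => // -[E _ E']; rewrite E E' eqxx in H.
Qed.

Lemma state_indep r c : earlier r c.+1 r0 c0 ->
  indep (fun X => state Delta n X r c) e.
Proof.
move=> rc X b; have loc := matched_local (upd_other X b).
have early r' c' : (r' <= r)%N -> (r' + c' <= r + c.+1)%N -> earlier r' c' r0 c0.
  by clear -rc; move: rc; rewrite /earlier; lia.
have [r1 rc1 rc2] : [/\ (r.-1 <= r)%N, (r + c <= r + c.+1)%N &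
    (r.-1 + c.+1 <= r + c.+1)%N] by split; lia.
have [A1 A2 A3 A4] := loc r c.+1 rc.
have [B1 _ _ _] := loc r c (early r c (leqnn _) rc1).
have [_ C2 _ _] := loc r.-1 c.+1 (early r.-1 c.+1 r1 rc2).
case: r {r1 rc1 rc2} rc early A1 A2 A3 A4 B1 C2 => [|r] rc early A1 A2 A3 A4 B1 C2.
  have z X' : heavyV X' 0 c.+2 = false by rewrite /heavyV matched_off ?andbF.
  by rewrite /state /left_over /= !z A1 A2 A3 B1 A4.
have [_ D2 _ _] : [/\ heavyH (upd X e b) r c.+2 = heavyH X r c.+2, 
    heavyV (upd X e b) r c.+2 = heavyV X r c.+2, 
    lightV (upd X e b) r.-1 c.+2 = lightV X r.-1 c.+2 &
    lightH (upd X e b) r c.+1 = lightH X r c.+1].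
  by apply: loc; apply: early; clear; lia.
by rewrite /state /left_over /= D2 A1 B1 A2 C2 A3 A4.
Qed.

Lemma input_indep r c : earlier r c.+3 r0 c0 ->
  indep (fun X => input Delta n X r.+1 c) e.
Proof.
move=> rc X b; have loc := matched_local (upd_other X b).
have early r' c' : (r' <= r)%N -> (r' + c' <= r + c.+3)%N -> earlier r' c' r0 c0.
  by clear -rc; move: rc; rewrite /earlier; lia.
have [rc2 rc1 r1 rcp] : [/\ (r + c.+2 <= r + c.+3)%N, (r + c.+1 <= r + c.+3)%N,
    (r.-1 <= r)%N & (r.-1 + c.+2 <= r + c.+3)%N] by split; lia.
have [_ A2 _ A4] := loc r c.+3 rc.
have [B1 B2 B3 B4] := loc r c.+2 (early _ _ (leqnn _) rc2).
have [C1 _ _ _] := loc r c.+1 (early _ _ (leqnn _) rc1).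
have [_ D2 _ _] := loc r.-1 c.+2 (early _ _ r1 rcp).
by rewrite /input /demand /left_over /= A2 B1 C1 B2 D2 B3 B4 A4.
Qed.

End Locality.

(** * One simultaneous step of the automata of consecutive rows *)

Section Slab.
Variables (R : realType) (Delta : R) (n : nat) (heavy : bool) (unit : BinNums.N).
Hypothesis Delta0 : 0 < Delta.
Implicit Types (X : uedge -> bool) (r c : nat).
Local Notation state := (state Delta n).
Local Notation input := (input Delta n).
Local Notation E := (expect (ugrid n)).

Definition valN (z : BinNums.N) : R := (N.to_nat z)%:R.

Lemma valND a b : valN (N.add a b) = valN a + valN b.
Proof. by rewrite /valN N2Nat.inj_add natrD. Qed.

Definition gain X r c : R :=
  valN (reward heavy unit (matched_now Delta n X r c)).

(** The automaton of row [r + j] is [j] columns behind that of row [r], so that its input is already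
    known. *)
Definition slab h (V : table h) X r c : R :=
  valN (look (fun j => state X (r + j) (c - j)) V).

Lemma look_ext h (V : table h) st st' :
  (forall j, (j < h)%N -> st j = st' j) -> look st V = look st' V.
Proof.
elim: h V st st' => //= h IHh V st st' H.
by rewrite H // (IHh _ _ (fun j => st' j.+1)) // => j jh; apply: H.
Qed.

(** The coins [e1] and [e2] are fresh for [F], so substituting them amounts to averaging over their
    four values. *)
Lemma expect_coin2 (F : (uedge -> bool) -> bool -> bool -> R) e1 e2 :
  e1 \in ugrid n -> e2 \in ugrid n -> e1 != e2 ->
  (forall b1 b2, indep (fun X => F X b1 b2) e1) ->
  (forall b1 b2, indep (fun X => F X b1 b2) e2) ->
  E (fun X => F X true true + F X true false + (F X false true + F X false false)) =
  4 * E (fun X => F X (X e1) (X e2)).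
Proof.
move=> g1 g2 e12 F1 F2; rewrite -[in RHS](expect_mean _ g1) -[in RHS](expect_mean _ g2).
rewrite -expectZ; apply: eq_expect => X; rewrite /mean.
have U1 Y b : upd Y e1 b e1 = b by rewrite /upd eqxx.
have U2 Y b : upd Y e2 b e2 = b by rewrite /upd eqxx.
have U3 Y b : upd Y e1 b e2 = Y e2 by rewrite /upd eq_sym (negbTE e12).
rewrite !U1 !U3 !U2.
have G b1 b2 b b' : F (upd (upd X e2 b) e1 b') b1 b2 = F X b1 b2.
  by rewrite (F1 b1 b2) (F2 b1 b2).
by rewrite !G; field.
Qed.

(** Induction on the number of rows, each bringing a factor 4 for its two coins. The table may
    depend on the coins because the new state of the first row is fixed in it before passing to the
    rows below; it must only ignore the coins that are still to be read. *)
Lemma slab_sweep h (V : (uedge -> bool) -> table h) r c :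
  (1 < r)%N -> (r + h <= n)%N -> (h <= c)%N -> (c.+2 < n)%N ->
  (forall d j, (j < h)%N -> indep V ((r + j)%N, d, (c - j).+2)) ->
  E (fun X => slab (qget (sweep heavy unit (V X)) (input X r c)) X r c) =
  4 ^+ h * E (fun X => slab (V X) X r c.+1 +
    if h is h'.+1 then gain X (r + h') (c - h') else 0).
Proof.
elim: h V r c => [|h IHh] V r c r1 rn hc cn Vind.
  rewrite expr0 mul1r; apply: eq_expect => X; rewrite addr0.
  by case: (input X r c) => [[|] [|]].
pose e1 := (r, false, c.+2); pose e2 := (r, true, c.+2).
have g1 : e1 \in ugrid n by rewrite mem_ugrid /in_grid /=; lia.
have g2 : e2 \in ugrid n by rewrite mem_ugrid /in_grid /=; lia.
have c0 : (0 < c)%N by lia.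
pose st X j := state X (r.+1 + j)%N (c.-1 - j)%N.
pose F X b1 b2 : R := valN (look (st X)
  (branch heavy unit (qof (fun s => sweep heavy unit (qget (V X) s)))
    (state X r c) (input X r c) b1 b2)).
have Find d b1 b2 : indep (fun X => F X b1 b2) (r, d, c.+2).
  move=> X b; have VX : V (upd X (r, d, c.+2) b) = V X.
    by have := Vind d 0%N isT; rewrite addn0 subn0; apply.
  have SX : state (upd X (r, d, c.+2) b) r c = state X r c.
    by apply: state_indep => //; rewrite /earlier; lia.
  have IX : input (upd X (r, d, c.+2) b) r c = input X r c.
    case: r r1 rn Vind {e1 e2 g1 g2 st F VX SX} => // r r1 rn Vind.
    by apply: input_indep => //; rewrite /earlier; lia.
  rewrite /F VX SX IX; congr valN; apply: look_ext => j jh.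
  by apply: state_indep => //; rewrite /earlier; lia.
have -> : E (fun X => slab (qget (sweep heavy unit (V X)) (input X r c)) X r c) =
    E (fun X => F X true true + F X true false + (F X false true + F X false false)).
  apply: eq_expect => X; rewrite /slab [look _ _]/= addn0 subn0 sweepS.
  rewrite !look_tmap2 !valND /F.
  have stE (t : table h) : look (fun j => state X (r + j.+1) (c - j.+1)) t = look (st X) t.
    by apply: look_ext => j _; rewrite /st; congr (state X _ _); lia.
  by rewrite !stE.
rewrite (expect_coin2 g1 g2) //; [|by rewrite !xpair_eqE /= andbF|exact: (Find false)|exact: (Find true)].
rewrite exprS -mulrA; congr (_ * _).
(* The table for the remaining rows, once the first row has moved to its next state. *)
pose V' X := qget (V X) (state X r c.+1).
have -> : E (fun X => F X (X e1) (X e2)) =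
    E (fun X => slab (qget (sweep heavy unit (V' X)) (input X r.+1 c.-1)) X r.+1 c.-1 +
       (if h is 0 then gain X r c else 0)).
  apply: eq_expect => X; rewrite /F.
  have := branchE heavy unit (V X) (state X r c) (input X r c) (X e1) (X e2) (st X).
  rewrite row_stepE //; last by lia.
  move=> ->; rewrite valND addrC; congr (_ + _).
  by case: (h).
rewrite expectD IHh //; try lia; last first.
  move=> d j jh X b; rewrite /V'.
  have -> : V (upd X ((r.+1 + j)%N, d, (c.-1 - j).+2) b) = V X.
    have -> : (r.+1 + j = r + j.+1)%N by lia.
    have -> : (c.-1 - j = c - j.+1)%N by lia.
    by apply: Vind.
  by congr qget; apply: state_indep => //; rewrite /earlier; lia.
have slabE X : slab (V' X) X r.+1 c.-1.+1 = slab (V X) X r c.+1.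
  rewrite /slab /= addn0 subn0; congr valN; apply: look_ext => j jh.
  by congr (state X _ _); lia.
under eq_expect do rewrite slabE.
case: h {IHh Vind V' F Find rn hc st slabE} V => [|h] V.
  by rewrite expr0 !mul1r -expectD; apply: eq_expect => X; rewrite addn0 subn0 addr0.
rewrite expect_const addr0; congr (_ * _); apply: eq_expect => X.
by congr (_ + gain X _ _); lia.
Qed.

End Slab.

(** * Lower bound on the number of matched edges *)

Section MatchedCount.
Variables (R : realType) (Delta : R) (heavy : bool) (unit : BinNums.N).
Hypothesis Delta0 : 0 < Delta.
Implicit Types (X : uedge -> bool) (r c n : nat).
Local Notation gain := (gain Delta).
Local Notation slab := (slab Delta).
Local Notation valN := (valN R).

(** The table acts as a potential. The certificate holds for all states and all inputs, so it
    applies in each configuration to the input really received, whatever its correlation with the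
    states. *)
Lemma slab_gain n h (V : table h.+1) kappa r c : certificate heavy unit kappa V ->
  (1 < r)%N -> (r + h < n)%N -> (h < c)%N -> (c.+2 < n)%N ->
  valN kappa + expect (ugrid n) (fun X => slab n V X r c) <=
  expect (ugrid n) (fun X => slab n V X r c.+1) +
  expect (ugrid n) (fun X => gain n heavy unit X (r + h) (c - h)).
Proof.
move=> cV r1 rn hc cn.
have rn' : (r + h.+1 <= n)%N by rewrite addnS.
have := slab_sweep heavy unit Delta0 (V := fun=> V) r1 rn' hc cn (fun _ _ _ _ _ => erefl).
rewrite -expectD => H.
have p4 : (0 : R) < 4 ^+ h.+1 by rewrite exprn_gt0 ?ltr0n.
rewrite -(ler_pM2l p4) -H -[in leLHS](expect_const (ugrid n) (valN kappa)) -expectD -expectZ.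
apply: ler_expect => X; have := certificateP cV (fun j => state Delta n X (r + j) (c - j))
  (input Delta n X r c).
by rewrite -(ler_nat R) natrM natrX natrD addrC.
Qed.

(** The inequality [slab_gain] telescopes along the columns, and the potential stays between 0 and
    [B]. *)
Lemma row_gain n h (V : table h.+1) kappa B r : certificate heavy unit kappa V ->
  (forall st, (N.to_nat (look st V) <= B)%N) ->
  (1 < r)%N -> (r + h < n)%N -> (h.+3 <= n)%N ->
  valN kappa * (n - h.+3)%:R - B%:R <= expect (ugrid n) (fun X =>
    \sum_(h.+1 <= c < n.-2) gain n heavy unit X (r + h) (c - h)).
Proof.
move=> cV VB r1 rn hn.
have telescope c : (c + h.+3 <= n)%N ->
    valN kappa * c%:R + expect (ugrid n) (fun X => slab n V X r h.+1) <=
    expect (ugrid n) (fun X => slab n V X r (c + h.+1)) + expect (ugrid n) (fun X =>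
      \sum_(h.+1 <= c < c + h.+1) gain n heavy unit X (r + h) (c - h)).
  elim: c => [|c IHc] cn.
    rewrite mulr0 !add0r add0n lerDl; under eq_expect do rewrite big_geq //.
    by rewrite expect_const.
  rewrite addSn; under [X in _ <= _ + X]eq_expect do rewrite big_nat_recr ?leq_addl //=.
  rewrite expectD -natr1 mulrDr mulr1.
  have h1 : (h < c + h.+1)%N by lia.
  have h2 : ((c + h.+1).+2 < n)%N by lia.
  have := slab_gain cV r1 rn h1 h2.
  have := IHc ltac:(lia).
  by lra.
have nE : (n.-2 = n - h.+3 + h.+1)%N by lia.
have := telescope (n - h.+3)%N; rewrite -nE subnK // leqnn => /(_ isT).
have slab0 : 0 <= expect (ugrid n) (fun X => slab n V X r h.+1).
  rewrite -[leLHS](expect_const (ugrid n)); apply: ler_expect => X.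
  exact: ler0n.
have slabB : expect (ugrid n) (fun X => slab n V X r n.-2) <= B%:R.
  rewrite -[leRHS](expect_const (ugrid n)); apply: ler_expect => X.
  by rewrite ler_nat.
by lra.
Qed.

Definition count_matched n X : R :=
  \sum_(x <- ugrid n) (umatched Delta n X x && (heavy ==> X x))%:R.

Lemma sum_le_grid n (f : uedge -> R) (s : seq uedge) : uniq s -> (forall x, 0 <= f x) ->
  (forall x, x \notin ugrid n -> f x = 0) ->
  \sum_(x <- s) f x <= \sum_(x <- ugrid n) f x.
Proof.
move=> us f0 fg; have -> : \sum_(x <- s) f x = \sum_(x <- ugrid n | x \in s) f x.
  rewrite (bigID (mem (ugrid n))) /= [X in _ + X]big1 => [|x /fg //].
  rewrite addr0 -big_filter -[RHS]big_filter; apply: perm_big.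
  apply: uniq_perm; rewrite ?filter_uniq ?ugrid_uniq // => x.
  by rewrite !mem_filter andbC.
rewrite big_mkcond; apply: ler_sum => x _; by case: ifP.
Qed.

(** The gain is split by weight and orientation of the edge. For each kind, distinct reading
    positions give distinct edges, so every matched edge is counted at most once. *)
Lemma gain_le_count n h X :
  \sum_(2 <= r < n - h) \sum_(h.+1 <= c < n.-2) gain n heavy unit X (r + h) (c - h) <=
  valN unit * count_matched n X.
Proof.
pose f k d x : R := ((x.1.2 == d) && (X x == k) && umatched Delta n X x)%:R.
pose rs := index_iota 2 (n - h); pose cs := index_iota h.+1 n.-2.
have box k d a b : (a <= h.+2)%N ->
    \sum_(r <- rs) \sum_(c <- cs) f k d ((r + h - a)%N, d, (c - h + b)%N) <=
    \sum_(x <- ugrid n) f k d x.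
  move=> ah; rewrite -(big_allpairs_dep (h := fun r c => ((r + h - a)%N, d, (c - h + b)%N))
    (r2 := fun=> cs) (F := f k d)).
  apply: sum_le_grid => [|x|x xg]; rewrite ?ler0n //; last first.
    by rewrite /f (contraNF (@umatched_grid _ _ _ _ _) xg) andbF.
  apply: allpairs_uniq; rewrite ?iota_uniq // => -[r c] [r' c'].
  move=> /allpairsP[[r1 c1] /= []]; rewrite !mem_index_iota => r1s c1s [-> ->].
  move=> /allpairsP[[r2 c2] /= []]; rewrite !mem_index_iota => r2s c2s [-> ->].
  by move=> [] E1 E2; congr (_, _); lia.
have gainE r c : gain n heavy unit X (r + h) (c - h) <= valN unit *
    (f true false ((r + h - 0)%N, false, (c - h + 2)%N) +
     f true true ((r + h - 0)%N, true, (c - h + 2)%N) +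
     (if heavy then 0 else f false true ((r + h - 1)%N, true, (c - h + 2)%N) +
       f false false ((r + h - 0)%N, false, (c - h + 1)%N))).
  rewrite /gain /f /= !eqb_id !eqbF_neg /reward /matched_now /= !subn0 subn1 addn2 addn1.
  rewrite -/(heavyH Delta n X (r + h) (c - h).+2) -/(heavyV Delta n X (r + h) (c - h).+2).
  rewrite -/(lightV Delta n X (r + h).-1 (c - h).+2).
  rewrite -/(lightH Delta n X (r + h) (c - h).+1).
  have u0 : 0 <= valN unit by exact: ler0n.
  have z0 : valN 0%num = 0 by [].
  move: (heavyH Delta n X (r + h) (c - h).+2) (heavyV Delta n X (r + h) (c - h).+2) => b1 b2.
  move: (lightV Delta n X (r + h).-1 (c - h).+2) (lightH Delta n X (r + h) (c - h).+1) => b3 b4.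
  rewrite (fun_if valN) z0; move: (valN unit) u0 => u u0.
  by case: heavy; case: b1; case: b2; case: b3; case: b4 => /=; lra.
have h1 : (0 <= h.+2)%N by [].
have h2 : (1 <= h.+2)%N by [].
have := box true false 0%N 2%N h1; have := box true true 0%N 2%N h1.
have := box false true 1%N 2%N h2; have := box false false 0%N 1%N h1.
have countE : \sum_(x <- ugrid n) f true false x + \sum_(x <- ugrid n) f true true x +
    (if heavy then 0 else \sum_(x <- ugrid n) f false true x +
      \sum_(x <- ugrid n) f false false x) <= count_matched n X.
  have -> : (if heavy then 0 else \sum_(x <- ugrid n) f false true x +
      \sum_(x <- ugrid n) f false false x) = \sum_(x <- ugrid n) (if heavy then 0 else
      f false true x + f false false x).
    by case: heavy; [rewrite big1 | rewrite big_split].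
  rewrite -!big_split /=; apply: ler_sum => x _; rewrite /f.
  by case: (x.1.2); case: (X x); case: (umatched Delta n X x); case: heavy => /=; lra.
move=> b1 b2 b3 b4.
apply: (@le_trans _ _ (valN unit * (
    \sum_(r <- rs) \sum_(c <- cs) f true false ((r + h - 0)%N, false, (c - h + 2)%N) +
    \sum_(r <- rs) \sum_(c <- cs) f true true ((r + h - 0)%N, true, (c - h + 2)%N) +
    (if heavy then 0 else
     \sum_(r <- rs) \sum_(c <- cs) f false true ((r + h - 1)%N, true, (c - h + 2)%N) +
     \sum_(r <- rs) \sum_(c <- cs) f false false ((r + h - 0)%N, false, (c - h + 1)%N))))).
  have -> : (if heavy then 0 else
     \sum_(r <- rs) \sum_(c <- cs) f false true ((r + h - 1)%N, true, (c - h + 2)%N) +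
     \sum_(r <- rs) \sum_(c <- cs) f false false ((r + h - 0)%N, false, (c - h + 1)%N)) =
     \sum_(r <- rs) \sum_(c <- cs) (if heavy then 0 else
      f false true ((r + h - 1)%N, true, (c - h + 2)%N) +
      f false false ((r + h - 0)%N, false, (c - h + 1)%N)).
    case: heavy; first by rewrite big1 // => *; rewrite big1.
    by rewrite -big_split; apply: eq_bigr => r _; rewrite -big_split.
  rewrite -!big_split mulr_sumr; apply: ler_sum => r _ /=.
  by rewrite -!big_split mulr_sumr; apply: ler_sum => c _ /=; exact: gainE.
rewrite ler_wpM2l ?ler0n //; apply: le_trans countE.
by move: b1 b2 b3 b4; case: heavy => b1 b2 b3 b4; rewrite !lerD.
Qed.

Lemma count_matched_lower h (V : table h.+1) kappa : certificate heavy unit kappa V ->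
  exists C : R, forall n, valN kappa * (n ^ 2)%:R - C * n%:R <=
    valN unit * expect (ugrid n) (count_matched n).
Proof.
move=> cV; have [B VB] := look_bounded V.
pose k := valN kappa; have k0 : 0 <= k by exact: ler0n.
(* The linear coefficient in [n] of (n - h - 2) (k (n - h - 3) - B), up to sign; the constant term
   of this product is nonnegative. *)
exists (k * (2 * h + 5)%:R + B%:R) => n.
have E0 : 0 <= valN unit * expect (ugrid n) (count_matched n).
  rewrite mulr_ge0 ?ler0n // -[leLHS](expect_const (ugrid n)); apply: ler_expect => X.
  by apply: sumr_ge0 => x _; exact: ler0n.
have [nh|hn] := ltnP n h.+3.
  apply: le_trans E0; rewrite subr_le0 mulrDl; apply: ler_wpDr.
    by rewrite mulr_ge0 ?ler0n.
  by rewrite -mulrA ler_wpM2l // -natrM ler_nat; nia.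
apply: (@le_trans _ _ ((n - h.+2)%:R * (k * (n - h.+3)%:R - B%:R))).
  rewrite !natrB; [|lia|lia]; rewrite natrX natrD natrM -!natr1.
  have : h%:R + 3 <= n%:R :> R by rewrite -natrD ler_nat; lia.
  have : 0 <= h%:R :> R by exact: ler0n.
  have : 0 <= B%:R :> R by exact: ler0n.
  move: (h%:R : R) (n%:R : R) (B%:R : R) => x y b b0 x0 xy.
  have p1 : 0 <= k * ((x + 2) * (x + 3)) by rewrite !mulr_ge0 ?addr_ge0.
  have p2 : 0 <= b * (x + 2) by rewrite mulr_ge0 ?addr_ge0.
  by nra.
rewrite -expectZ; apply: (@le_trans _ _ (expect (ugrid n) (fun X =>
  \sum_(2 <= r < n - h) \sum_(h.+1 <= c < n.-2) gain n heavy unit X (r + h) (c - h)))).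
  rewrite expect_sum.
  have -> : (n - h.+2)%:R * (k * (n - h.+3)%:R - B%:R) =
      \sum_(2 <= r < n - h) (k * (n - h.+3)%:R - B%:R) :> R.
    by rewrite big_const_nat iter_addr_0 mulr_natl; congr (_ *+ _); lia.
  rewrite big_nat [leRHS]big_nat; apply: ler_sum => r /andP[r2 rn].
  by apply: row_gain => //; lia.
by apply: ler_expect => X; exact: gain_le_count.
Qed.

End MatchedCount.

(** * Limits *)

Local Open Scope classical_set_scope.
Local Open Scope ring_scope.

Section GridLimit.
Variables (R : realType) (Delta : R).
Hypothesis Delta0 : 0 < Delta.

Lemma block_sub n k i j : (0 < k)%N -> (i.+1 * k <= n)%N -> (j.+1 * k <= n)%N ->
  {subset map (shift (i * k) (j * k)) (ugrid k) <= ugrid n}.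
Proof. by move=> ? ? ? e; rewrite -(@ugrid_block n) // mem_filter => /andP[]. Qed.

Lemma expect_block opt n k i j :
  (0 < k)%N -> (i.+1 * k <= n)%N -> (j.+1 * k <= n)%N ->
  expect (ugrid n) (gvalue Delta opt (map (shift (i * k) (j * k)) (ugrid k))) =
  Egrid Delta opt k.
Proof.
move=> k0 ik jk; rewrite (expect_sub (block_sub k0 ik jk)); last first.
  by move=> e _; exact: gvalue_indep.
rewrite (eq_expect _ (gvalue_shift Delta opt _ _ _)).
exact: (expect_map _ _ (@shift_inj _ _)).
Qed.

(** Deleting all the edges leaves value 0, so [value_filter] bounds the whole value. *)
Lemma Egrid_le opt k : `|Egrid Delta opt k| <= 4 * (1 + Delta) * (k ^ 2)%:R.
Proof.
apply: le_trans (ler_norm_expect _ _) _.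
rewrite -[leRHS](expect_const (ugrid k)); apply: ler_expect => X.
have K0 : 0 <= 1 + Delta by rewrite addr_ge0 // ltW.
have := value_filter usrc udst opt (fun=> false) xpred0 K0
  (heaviest_heavy_first Delta0 X (ugrid k)) (fun e _ => wt_itv Delta0 X e).
rewrite filter_pred0 /= subr0 => /le_trans; apply.
rewrite (permP (perm_heavy_first X (ugrid k))).
rewrite (@eq_count _ _ xpredT) // count_predT size_ugrid.
rewrite natrM mulrA [2 * _ * 2]mulrAC -[2 * 2]natrM ler_wpM2l ?mulr_ge0 //.
by rewrite ler_nat leq_mul // leq_pred.
Qed.

Lemma Egrid_blocks opt n k (q := (n %/ k)%N) : (0 < k)%N ->
  `|Egrid Delta opt n - (q ^ 2)%:R * Egrid Delta opt k|
  <= 2 * (1 + Delta) * (2 * (n * n.-1) - q ^ 2 * (2 * (k * k.-1)))%:R.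
Proof.
move=> k0.
have -> : (q ^ 2)%:R * Egrid Delta opt k = expect (ugrid n) (fun X =>
    \sum_(i < q) \sum_(j < q) gvalue Delta opt (map (shift (i * k) (j * k)) (ugrid k)) X).
  rewrite expect_sum.
  under eq_bigr => i _ do rewrite expect_sum.
  have qn (i : 'I_q) : (i.+1 * k <= n)%N by rewrite -leq_divRL.
  under eq_bigr => i _ do under eq_bigr => j _ do rewrite expect_block //.
  by rewrite !sumr_const !card_ord -mulrnA mulr_natl mulnn.
rewrite -expectB; apply: le_trans (ler_norm_expect _ _) _.
rewrite -[leRHS](expect_const (ugrid n)); apply: ler_expect => X.
exact: gvalue_blocks.
Qed.

(** At most [4 * k * n + 2 * q ^ 2 * k] edges are deleted. After division by [n ^ 2], the bound
    [q * k <= n] makes this of order k / n + 1 / k. Replacing the factor [q ^ 2] by (n / k)^2 costs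
    order k / n more, since [q ^ 2 * k ^ 2] differs from [n ^ 2] by at most [2 * k * n]. *)
Lemma Egrid_density opt n k : (0 < k)%N -> (0 < n)%N ->
  `|Egrid Delta opt n / (n ^ 2)%:R - Egrid Delta opt k / (k ^ 2)%:R| <=
  16 * (1 + Delta) * (k%:R / n%:R + k%:R^-1).
Proof.
move=> k0 n0; set q := (n %/ k)%N.
have K0 : 0 <= 1 + Delta by rewrite addr_ge0 // ltW.
move: (Egrid_blocks opt n k0) (Egrid_le opt k); rewrite -/q.
move: (Egrid Delta opt n) (Egrid Delta opt k) => a b.
rewrite !natrX.
have nE : (n = q * k + n %% k)%N by exact: divn_eq.
have : (n %% k < k)%N by rewrite ltn_mod.
move: nE; move: (n %% k)%N => s nE sk.
have : ((2 * (n * n.-1) - q ^ 2 * (2 * (k * k.-1))) <= 4 * k * n + 2 * q ^ 2 * k)%N.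
  rewrite leq_subLR.
  have -> : (2 * (n * n.-1) = 2 * n * n - 2 * n)%N by nia.
  have -> : (q ^ 2 * (2 * (k * k.-1)) = 2 * q ^ 2 * k * k - 2 * q ^ 2 * k)%N by nia.
  have : (2 * n * n <= 2 * q ^ 2 * k * k + 4 * k * n)%N by nia.
  have : (2 * q ^ 2 * k <= 2 * q ^ 2 * k * k)%N by nia.
  lia.
rewrite -(ler_nat R) => D a_b bK.
have {}D := le_trans a_b (ler_wpM2l (mulr_ge0 (ler0n R 2) K0) D).
have {nE sk} : [/\ (q%:R * k%:R <= n%:R :> R), n%:R <= q%:R * k%:R + k%:R :> R,
   0 < k%:R :> R, 0 < n%:R :> R & 0 <= q%:R :> R].
  by split; rewrite ?ltr0n ?ler0n // -natrM -?natrD ler_nat; lia.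
move: D; rewrite !natrD !natrM.
move: (k%:R : R) (n%:R : R) (q%:R : R) a_b bK => x y z _ bK D [zx yx x0 y0 z0].
move: (1 + Delta) K0 bK D => K K0 bK D.
have zx2 : z ^+ 2 * x ^+ 2 <= y ^+ 2.
  by rewrite -exprMn lerXn2r // nnegrE ?mulr_ge0 // ltW.
have yzx : `|z ^+ 2 * x ^+ 2 - y ^+ 2| <= 2 * x * y.
  rewrite ler_norml; apply/andP; split; last by nra.
  have : (y - z * x) * (y + z * x) <= x * (2 * y).
    have zx0 : 0 <= z * x by rewrite mulr_ge0 // ltW.
    by apply: ler_pM; lra.
  lra.
have -> : a / y ^+ 2 - b / x ^+ 2 =
    ((a - z ^+ 2 * b) * x ^+ 2 + b * (z ^+ 2 * x ^+ 2 - y ^+ 2)) / (x ^+ 2 * y ^+ 2).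
  by field; rewrite !gt_eqF.
rewrite normf_div [`|x ^+ 2 * _|]gtr0_norm ?mulr_gt0 ?exprn_gt0 //.
rewrite ler_pdivrMr ?mulr_gt0 ?exprn_gt0 //.
have -> : 16 * K * (x / y + x^-1) * (x ^+ 2 * y ^+ 2) = 16 * K * (x ^+ 3 * y + x * y ^+ 2).
  by field; rewrite !gt_eqF.
apply: le_trans (ler_normD _ _) _.
rewrite [`|_ * x ^+ 2|]normrM [`|b * _|]normrM [`|x ^+ 2|]ger0_norm ?exprn_ge0 // ?(ltW x0) //.
have h1 : `|a - z ^+ 2 * b| * x ^+ 2 <= 2 * K * (4 * x * y + 2 * (z * z) * x) * x ^+ 2.
  by rewrite ler_wpM2r // exprn_ge0 // ltW.
have h2 : `|b| * `|z ^+ 2 * x ^+ 2 - y ^+ 2| <= 4 * K * x ^+ 2 * (2 * x * y).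
  by apply: ler_pM.
have h3 : K * x * (z ^+ 2 * x ^+ 2) <= K * x * y ^+ 2.
  by rewrite ler_wpM2l // mulr_ge0 // ltW.
have h4 : 0 <= K * x * y ^+ 2 by rewrite !mulr_ge0 ?exprn_ge0 // ltW.
apply: le_trans (lerD h1 h2) _; lra.
Qed.

Lemma Egrid_cvg opt : exists l : R,
  Egrid Delta opt n / (n ^ 2)%:R @[n --> \oo] --> l.
Proof.
suff : cvgn (fun n => Egrid Delta opt n / (n ^ 2)%:R) by move=> ?; eexists; eassumption.
apply/cauchy_cvgP/cauchy_exP => eps eps0.
pose C := 16 * (1 + Delta).
have C0 : 0 < C by rewrite mulr_gt0 ?ltr0n // addr_gt0.
(* The block size is fixed first, to control the term 1 / k; the term k / n then vanishes as [n]
   grows. *)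
have [k k0 kC] : exists2 k, (0 < k)%N & C * k%:R^-1 < eps / 2.
  exists (Num.truncn (C / (eps / 2))).+1 => //.
  rewrite ltr_pdivrMr ?ltr0n // mulrC -ltr_pdivrMr ?divr_gt0 //.
  by rewrite truncnS_gt.
exists (Egrid Delta opt k / (k ^ 2)%:R).
change (\forall n \near \oo, ball (Egrid Delta opt k / (k ^ 2)%:R) eps
  (Egrid Delta opt n / (n ^ 2)%:R)).
near=> n.
have n0 : (0 < n)%N by near: n; exact: nbhs_infty_gt.
have nC : C * (k%:R / n%:R) < eps / 2.
  rewrite mulrA ltr_pdivrMr ?ltr0n // -ltr_pdivrMl ?divr_gt0 //.
  by near: n; exact: nbhs_infty_gtr.
rewrite -ball_normE /= distrC; apply: le_lt_trans (Egrid_density _ k0 n0) _.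
by rewrite -/C mulrDr; lra.
Unshelve. all: by end_near.
Qed.

End GridLimit.

(** * Limits of the densities and of the performance ratio *)

Section Density.
Variables (R : realType) (Delta : R).
Hypothesis Delta0 : 0 < Delta.

Lemma fhat_count n X : fhat (@cell_idx n) (fun e => wt Delta X (uof e)) =
  count_matched Delta false n X + Delta * count_matched Delta true n X.
Proof.
rewrite fhat_umatched /count_matched mulr_sumr -big_split /= big_mkcond.
apply: eq_bigr => x _; rewrite /wt /two_values.
by case: ifP => _; case: (X x) => /=; rewrite ?mulr1 ?mulr0 ?addr0.
Qed.

Lemma Egrid_fhat n : Egrid Delta false n =
  expected_weight Delta (@fhat _ (@grid_adj n) R (@cell_idx n)).
Proof. by rewrite expected_weightE; apply: eq_expect => X; rewrite fhat_gvalue. Qed.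

Lemma Egrid_fstar n : Egrid Delta true n =
  expected_weight Delta (@fstar _ (@grid_adj n) R).
Proof. by rewrite expected_weightE; apply: eq_expect => X; rewrite fstar_gvalue. Qed.

Lemma Egrid_fhat_le_fstar n : Egrid Delta false n <= Egrid Delta true n.
Proof.
apply: ler_expect => X; rewrite -fhat_gvalue // -fstar_gvalue //.
by apply: le_bigmax_cond; apply: greedy_matching; exact: cell_idx_inj.
Qed.

Lemma Egrid_lower (p q : R) : p * 10000 <= 4607 -> q * 1000 <= 349 ->
  exists C : R, forall n, (p + q * Delta) * (n ^ 2)%:R - C * n%:R <= Egrid Delta false n.
Proof.
move=> p_le q_le.
have [C1 H1] := count_matched_lower Delta0 total_certificate.
have [C2 H2] := count_matched_lower Delta0 heavy_certificate.
have v1 : valN R 10000 = 10000 by rewrite /valN; congr _%:R; vm_compute.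
have v2 : valN R 4607 = 4607 by rewrite /valN; congr _%:R; vm_compute.
have v3 : valN R 1000 = 1000 by rewrite /valN; congr _%:R; vm_compute.
have v4 : valN R 349 = 349 by rewrite /valN; congr _%:R; vm_compute.
have u1 : (0 : R) < 10000 by rewrite ltr0n.
have u2 : (0 : R) < 1000 by rewrite ltr0n.
have {v1 v2}H1 n : 4607 * (n ^ 2)%:R - C1 * n%:R <=
    10000 * expect (ugrid n) (count_matched Delta false n) by rewrite -v1 -v2.
have {v3 v4}H2 n : 349 * (n ^ 2)%:R - C2 * n%:R <=
    1000 * expect (ugrid n) (count_matched Delta true n) by rewrite -v3 -v4.
move: (10000 : R) (4607 : R) (1000 : R) (349 : R) u1 u2 p_le q_le H1 H2.
move=> u1 k1 u2 k2 u1_gt0 u2_gt0 p_le q_le H1 H2.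
exists (C1 / u1 + Delta * (C2 / u2)) => n.
have -> : Egrid Delta false n = expect (ugrid n) (count_matched Delta false n) +
    Delta * expect (ugrid n) (count_matched Delta true n).
  rewrite -expectZ -expectD; apply: eq_expect => X.
  by rewrite -fhat_gvalue // fhat_count.
have scaled (k a u w y z : R) : 0 < u -> 0 <= y -> a * u <= k ->
    k * y - w * n%:R <= u * z -> a * y - w / u * n%:R <= z.
  move=> u0 y0 ak h; rewrite -(ler_pM2l u0); apply: le_trans h.
  have -> : u * (a * y - w / u * n%:R) = a * u * y - w * n%:R by field; rewrite gt_eqF.
  by rewrite lerD2r ler_wpM2r.
have g1 := scaled _ _ _ _ _ _ u1_gt0 (ler0n _ _) p_le (H1 n).
have g2 := scaled _ _ _ _ _ _ u2_gt0 (ler0n _ _) q_le (H2 n).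
apply: le_trans (lerD g1 (ler_wpM2l (ltW Delta0) g2)).
by rewrite le_eqVlt; apply/orP; left; apply/eqP; ring.
Qed.

(** For n > C / eps the boundary term [C * n%:R] is smaller than [eps] times the area of the
    grid. *)
Lemma limit_ge (u : nat -> R) (a C l : R) :
  u n / (n ^ 2)%:R @[n --> \oo] --> l ->
  (forall n, a * (n ^ 2)%:R - C * n%:R <= u n) -> a <= l.
Proof.
move=> ul au; apply/ler_addgt0Pr => eps eps0; rewrite -lerBlDr.
apply: (ler_cvg_to (cvg_cst (a - eps)) ul); near=> n.
have n0 : (0 < n)%N by near: n; exact: nbhs_infty_gt.
have nC : C / eps < n%:R by near: n; exact: nbhs_infty_gtr.
rewrite ler_pdivlMr ?ltr0n ?expn_gt0 ?n0 //; apply: le_trans (au n).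
rewrite mulrBl lerD2l lerN2 natrX expr2 mulrA ler_wpM2r ?ler0n //.
by rewrite mulrC -ler_pdivrMr // ltW.
Unshelve. all: by end_near.
Qed.

(** The rate is half of 0.9213, because the bound on the optimum per cell carries the same factor
    1/2. *)
Lemma total_rate : 9213 / 20000 * 10000 <= 4607 :> R.
Proof. by lra. Qed.

Lemma heavy_rate : 6967 / 20000 * 1000 <= 349 :> R.
Proof. by lra. Qed.

Lemma PR_limit : exists l : R, (PR n Delta @[n --> \oo] --> l) /\ lower_bound Delta <= l.
Proof.
have D0 := Delta0; have [l1 cv1] := Egrid_cvg Delta0 false; have [l2 cv2] := Egrid_cvg Delta0 true.
have [C HC] := Egrid_lower total_rate heavy_rate.
have l1_ge := limit_ge cv1 HC.
(* This makes the limit of the denominator positive, so that the limit of the quotient can be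
   taken. *)
have l12 : l1 <= l2.
  apply: (ler_cvg_to cv1 cv2); near=> n.
  by rewrite ler_wpM2r ?invr_ge0 ?ler0n // Egrid_fhat_le_fstar.
have l2_le : l2 <= 2^-1 * (1 + 15 / 16 * Delta).
  apply: (ler_cvg_to cv2 (cvg_cst _)); near=> n.
  have n0 : (0 < n)%N by near: n; exact: nbhs_infty_gt.
  by rewrite ler_pdivrMr ?ltr0n ?expn_gt0 ?n0 // mulrC Egrid_upper.
have l1_gt0 : 0 < l1.
  by apply: lt_le_trans l1_ge; clear -D0; lra.
have l2_gt0 := lt_le_trans l1_gt0 l12.
exists (l1 / l2); split; last first.
  have d0 : 0 < 1 + 9375 / 10000 * Delta by clear -D0; lra.
  rewrite /lower_bound ler_pdivrMr //.
  apply: (@le_trans _ _ (l1 / l2 * (2 * l2))); last first.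
    rewrite ler_wpM2l //; first by rewrite divr_ge0 // ltW.
    by clear -l2_le; lra.
  have -> : l1 / l2 * (2 * l2) = 2 * l1 by field; rewrite gt_eqF.
  by clear -l1_ge; lra.
apply: cvg_trans (cvgM cv1 (cvgV (lt0r_neq0 l2_gt0) cv2)).
apply: near_eq_cvg; near=> n.
have n0 : (n ^ 2)%:R != 0 :> R.
  by rewrite pnatr_eq0 -lt0n expn_gt0; apply/orP; left; near: n; exact: nbhs_infty_gt.
rewrite /PR -Egrid_fhat -Egrid_fstar /=.
by rewrite invf_div mulrA divfK.
Unshelve. all: by end_near.
Qed.

End Density.

(** * Monotonicity and end values of the bound *)

Section LowerBound.
Variable R : realType.

(** Partial fractions: once the value [b / d] at infinity is split off, monotonicity and the limit
    at infinity depend only on [1 + d * x] and on the sign of [a - b / d]. *)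
Lemma homographicE (a b d x : R) : 0 < d -> 0 <= x ->
  (a + b * x) / (1 + d * x) = b / d + (a - b / d) / (1 + d * x).
Proof.
move=> d0 x0; have dx : 1 + d * x != 0.
  by rewrite gt_eqF // ltr_pwDl ?ltr01 // mulr_ge0 // ltW.
by field; rewrite dx gt_eqF.
Qed.

Lemma homographic_decreasing (a b d x y : R) : 0 < d -> b / d < a -> 0 < x -> x < y ->
  (a + b * y) / (1 + d * y) < (a + b * x) / (1 + d * x).
Proof.
move=> d0 ba x0 xy; have y0 := lt_trans x0 xy.
rewrite !homographicE ?ltW // ltrD2l ltr_pM2l ?subr_gt0 //.
have dx z : 0 < z -> 0 < 1 + d * z by move=> z0; rewrite addr_gt0 ?mulr_gt0.
by rewrite ltf_pV2 ?posrE ?dx // ltrD2l ltr_pM2l.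
Qed.

Lemma homographic_cvg0 (a b d : R) :
  (a + b * x) / (1 + d * x) @[x --> (0 : R)^'+] --> a.
Proof.
apply: cvg_at_right_filter.
have affine (u v : R) : u + v * x @[x --> (0 : R)] --> u + v * 0.
  exact: (cvgD (cvg_cst u) (cvgM (cvg_cst v) cvg_id)).
have d0 : 1 + d * 0 != 0 by rewrite mulr0 addr0 oner_neq0.
have := cvgM (affine a b) (cvgV d0 (affine 1 d)).
by rewrite !mulr0 !addr0 divr1 => H; exact: H.
Qed.

Lemma homographic_cvgy (a b d : R) : 0 < d -> b / d < a ->
  (a + b * x) / (1 + d * x) @[x --> +oo] --> b / d.
Proof.
move=> d0 ba; apply/cvgrPdist_lt => eps eps0; near=> x.
have x0 : 0 < x by near: x; exact: nbhs_pinfty_gt.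
have xe : (a - b / d) / (eps * d) < x.
  by near: x; apply: nbhs_pinfty_gt; exact: num_real.
have dx : 0 < 1 + d * x by rewrite addr_gt0 ?mulr_gt0.
have ab : 0 < a - b / d by rewrite subr_gt0.
rewrite homographicE // ?ltW // opprD addrA subrr sub0r normrN gtr0_norm ?divr_gt0 //.
rewrite ltr_pdivrMr // mulrDr mulr1 mulrA; apply: ltr_wpDl; first exact: ltW.
by rewrite -ltr_pdivrMl ?mulr_gt0 // mulrC.
Unshelve. all: by end_near.
Qed.

Lemma slope_gt0 : (0 : R) < 9375 / 10000.
Proof. by lra. Qed.

Lemma limits_lt : 6967 / 10000 / (9375 / 10000) < 9213 / 10000 :> R.
Proof. by rewrite ltr_pdivrMr ?slope_gt0 //; lra. Qed.

Lemma limit0_rounds : rounds_to_permille (9213 / 10000 : R) 921.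
Proof. by rewrite /rounds_to_permille ltr_norml; apply/andP; split; lra. Qed.

Lemma limity_rounds : rounds_to_permille (6967 / 10000 / (9375 / 10000) : R) 743.
Proof.
rewrite /rounds_to_permille ltr_norml; apply/andP; split.
  by rewrite ltrBrDr ltr_pdivlMr ?slope_gt0 //; lra.
by rewrite ltrBlDr ltr_pdivrMr ?slope_gt0 //; lra.
Qed.

End LowerBound.

Theorem proposition8 (R : realType) :
  (forall Delta : R, 0 < Delta ->
     exists l : R,
       (PR n Delta @[n --> \oo] --> l) /\
       lower_bound Delta <= l)
  /\
  (forall Delta Delta' : R, 0 < Delta -> Delta < Delta' ->
     lower_bound Delta' < lower_bound Delta)
  /\
  (exists l0 : R,
     (lower_bound Delta @[Delta --> 0^'+] --> l0) /\
     rounds_to_permille l0 921)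
  /\
  (exists linf : R,
     (lower_bound Delta @[Delta --> +oo] --> linf) /\
     rounds_to_permille linf 743).
Proof.
split; first by move=> Delta; exact: PR_limit.
have slope_gt0 := slope_gt0 R; have ba := limits_lt R.
split; first by move=> Delta Delta'; exact: (homographic_decreasing slope_gt0 ba).
split.
  exists (9213 / 10000); split; last exact: limit0_rounds.
  exact: (@homographic_cvg0 R (9213 / 10000) (6967 / 10000) (9375 / 10000)).
exists (6967 / 10000 / (9375 / 10000)); split; last exact: limity_rounds.
exact: (homographic_cvgy slope_gt0 ba).
Qed.
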